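(* Let $L$ be a logic over a finite alphabet $\Sigma$ such that the class of its models $\mathsf{Mod}(L)$ admits definable filtration. Then, for every $n<\omega$: (i) $\mathsf{Mod}(L^{(n)})$ admits definable filtration. (ii) $L^{(n)}$ has the finite model property; a fortiori, $L^{(n)}$ is Kripke complete. (iii) If $L$ is finitely axiomatizable, then $L^{(n)}$ is decidable. (iv) If the class of finite frames of $L$ is decidable, then $L^{(n)}$ is co-recursively enumerable.
   Context: Formulas. For a finite alphabet $\Sigma$ of indices, $\mathrm{Fm}(\Sigma)$ is the set of modal formulas built from propositional variables $p_0,p_1,\dots$ using $\bot$, $\to$ and unary modalities $[e]$, $e\in\Sigma$. A set $\Gamma$ of formulas is Sub-closed if it contains all subformulas of its members. Semantics. A ($\Sigma$-)frame is $F=(W,(R_e)_{e\in\Sigma})$ with $W\neq\varnothing$ and $R_e\subseteq W\times W$; a model on $F$ is $M=(F,V)$ with $V(p)\subseteq W$ for each variable $p$. Truth $M,x\models\varphi$ is standard ($M,x\models[e]\varphi$ iff $M,y\models\varphi$ for all $y$ with $xR_ey$). $M\models\varphi$ means truth at all points; $F\models\varphi$ means $M\models\varphi$ for all models $M$ on $F$. A (normal) logic over $\Sigma$ is a set of $\Sigma$-formulas containing all classical tautologies and all $[e](p\to q)\to([e]p\to[e]q)$, closed under modus ponens, substitution and necessitation. $\mathsf{Mod}(L)$ is the class of all models $M$ with $M\models L$; a frame of $L$ is a frame $F$ with $F\models L$. A logic is Kripke complete if it is the set of all formulas valid in some class of frames; it has the finite model property if it is the set of all formulas valid in some class of finite frames.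 PDL-like expansion. For an alphabet $\Sigma$ let $\Sigma^{\sharp}=\Sigma\cup\{(e\circ f),(e\cup f),e^+\mid e,f\in\Sigma\}$, assuming that the added symbols are not in $\Sigma$. For a logic $L$ over $\Sigma$, $L^{\sharp}$ is the smallest (normal) logic over $\Sigma^{\sharp}$ that contains $L$ and the following axioms for all $e,c\in\Sigma$: $[e\cup c]p\leftrightarrow[e]p\wedge[c]p$; $[e\circ c]p\leftrightarrow[e][c]p$; $[e^+]p\to[e]p$; $[e^+]p\to[e][e^+]p$; $[e^+](p\to[e]p)\to([e]p\to[e^+]p)$. Put $L^{(0)}=L$ and $L^{(n+1)}=(L^{(n)})^{\sharp}$ (a logic over $\Sigma^{(n+1)}$, where $\Sigma^{(0)}=\Sigma$, $\Sigma^{(n+1)}=(\Sigma^{(n)})^\sharp$). Filtration. Let $M=(W,(R_e)_{e\in\Sigma},V)$ be a model. For a set $\Phi$ of formulas, $x\sim_\Phi y$ iff for all $\varphi\in\Phi$: $M,x\models\varphi\Leftrightarrow M,y\models\varphi$. Let $\Gamma$ be a finite Sub-closed set of formulas. A $\Gamma$-filtration of $M$ is a model $\widehat M=(\widehat W,(\widehat R_e)_{e\in\Sigma},\widehat V)$ such that: $\widehat W=W/{\sim}$ for some equivalence relation $\sim$ on $W$ with finitely many classes and with $\sim\,\subseteq\,\sim_\Gamma$; for all variables $p\in\Gamma$ and $x\in W$, $\widehat M,\widehat x\models p$ iff $M,x\models p$, where $\widehat x$ is the $\sim$-class of $x$; and for each $e\in\Sigma$, $R^{\min}_{\sim,e}\subseteq\widehat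 R_e\subseteq R^{\max}_{\Gamma,e}$, where $\widehat x\,R^{\min}_{\sim,e}\,\widehat y$ iff there are $x'\sim x$, $y'\sim y$ with $x'R_ey'$, and $\widehat x\,R^{\max}_{\Gamma,e}\,\widehat y$ iff for every formula $[e]\varphi\in\Gamma$, $M,x\models[e]\varphi$ implies $M,y\models\varphi$. The filtration is definable if $\sim\,=\,\sim_\Phi$ for some finite set of formulas $\Phi$. A class of models $\mathcal M$ admits definable filtration if for every finite Sub-closed set of formulas $\Gamma$ and every $M\in\mathcal M$ there is a model in $\mathcal M$ that is a definable $\Gamma$-filtration of $M$. *)

(* Defs.v *)
From HB Require Import structures.
From mathcomp Require Import all_boot.
From mathcomp Require Import boolp classical_sets functions cardinality.
From Corelib Require Import RelationClasses.

Set Implicit Arguments.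
Unset Strict Implicit.
Unset Printing Implicit Defensive.

Local Open Scope classical_set_scope.

(** * Formulas and logics *)

Inductive fm (S : Type) : Type :=
  | Bot
  | Var of nat
  | Imp of fm S & fm S
  | Box of S & fm S.
Arguments Bot {S}.
Arguments Var {S} _.

Section Formulas.
Variable S : Type.
Implicit Types (a b phi psi : fm S).

Definition Neg a : fm S := Imp a Bot.
Definition And a b : fm S := Neg (Imp a (Neg b)).
Definition Iff a b : fm S := And (Imp a b) (Imp b a).

Fixpoint subformula psi phi : Prop :=
  psi = phi \/
  match phi with
  | Imp a b => subformula psi a \/ subformula psi b
  | Box _ a => subformula psi a
  | _ => False
  end.

Definition sub_closed (G : set (fm S)) : Prop :=
  forall phi psi, G phi -> subformula psi phi -> G psi.

Fixpoint subst (s : nat -> fm S) phi : fm S :=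
  match phi with
  | Bot => Bot
  | Var i => s i
  | Imp a b => Imp (subst s a) (subst s b)
  | Box e a => Box e (subst s a)
  end.

(* Variables and boxed formulas are the propositional atoms. *)
Fixpoint prop_eval (v : fm S -> bool) phi : bool :=
  match phi with
  | Bot => false
  | Imp a b => prop_eval v a ==> prop_eval v b
  | Var _ | Box _ _ => v phi
  end.

Definition tautology phi : Prop := forall v, prop_eval v phi.

Definition axiomK (e : S) : fm S :=
  Imp (Box e (Imp (Var 0) (Var 1))) (Imp (Box e (Var 0)) (Box e (Var 1))).

Record is_logic (L : set (fm S)) : Prop := IsLogic {
  logic_taut : forall phi, tautology phi -> L phi;
  logic_K : forall e, L (axiomK e);
  logic_mp : forall a b, L (Imp a b) -> L a -> L b;
  logic_subst : forall s a, L a -> L (subst s a);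
  logic_nec : forall e a, L a -> L (Box e a)
}.

Definition least_logic (X : set (fm S)) : set (fm S) :=
  [set phi | forall L, is_logic L -> X `<=` L -> L phi].

Definition finitely_axiomatizable (L : set (fm S)) : Prop :=
  exists X : set (fm S), finite_set X /\ L = least_logic X.

End Formulas.

(** * Kripke semantics *)

Record frame (S : Type) := Frame {
  world : Type;
  world_inhabited : inhabited world;
  acc : S -> world -> world -> Prop
}.

Record model (S : Type) := Model {
  model_frame :> frame S;
  val : nat -> world model_frame -> Prop
}.

Section Semantics.
Variable S : Type.
Implicit Types (M : model S) (F : frame S) (L : set (fm S)) (phi : fm S).

Fixpoint sat M (x : world M) phi : Prop :=
  match phi with
  | Bot => False
  | Var i => val i x
  | Imp a b => sat x a -> sat x b
  | Box e a => forall y, acc e x y -> sat y a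
  end.

Definition model_valid M phi : Prop := forall x : world M, sat x phi.

Definition frame_valid F phi : Prop :=
  forall V : nat -> world F -> Prop, model_valid (Model V) phi.

(* Classes of frames and of models are plain predicates rather than [set]s, in
   order not to put the (large) types of frames and models in the universe that
   [set] is applied to elsewhere. *)
Definition Mod L : model S -> Prop :=
  fun M => forall phi, L phi -> model_valid M phi.

Definition frame_of L : frame S -> Prop :=
  fun F => forall phi, L phi -> frame_valid F phi.

Definition finite_frame F : Prop := finite_set [set: world F].

Definition logic_of_frames (C : frame S -> Prop) : set (fm S) :=
  [set phi | forall F, C F -> frame_valid F phi].

Definition kripke_complete L : Prop :=
  exists C : frame S -> Prop, L = logic_of_frames C.

Definition finite_model_property L : Prop :=
  exists C : frame S -> Prop,
    (forall F, C F -> finite_frame F) /\ L = logic_of_frames C.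

End Semantics.

(** * Filtrations *)

Section Quotient.
Variables (W : Type) (r : W -> W -> Prop).

Definition quot : Type := {C : W -> Prop | exists x, C = r x}.

Definition cls (x : W) : quot := exist _ (r x) (ex_intro _ x erefl).

Lemma quot_inhabited : inhabited W -> inhabited quot.
Proof. by case=> x; constructor; exact: cls x. Qed.

End Quotient.

Section Filtration.
Variables (S : Type) (M : model S).
Implicit Types (G P : set (fm S)) (r : world M -> world M -> Prop).

Definition fm_equiv P (x y : world M) : Prop :=
  forall phi, P phi -> (sat x phi <-> sat y phi).

(* [rmin] and [rmax] are given on representatives. *)
Definition rmin r (e : S) (x y : world M) : Prop :=
  exists x' y', [/\ r x x', r y y' & acc e x' y'].

Definition rmax G (e : S) (x y : world M) : Prop :=
  forall phi, G (Box e phi) -> sat x (Box e phi) -> sat y phi.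

Definition quot_model r (R : S -> quot r -> quot r -> Prop)
    (V : nat -> quot r -> Prop) : model S :=
  @Model S (Frame (quot_inhabited r (world_inhabited M)) R) V.

Record is_filtration G r (R : S -> quot r -> quot r -> Prop)
    (V : nat -> quot r -> Prop) : Prop := IsFiltration {
  filtr_equiv : Equivalence r;
  filtr_finite : finite_set [set: quot r];
  filtr_refines : forall x y, r x y -> fm_equiv G x y;
  filtr_val : forall p (x : world M), G (Var p) ->
    (@sat S (quot_model R V) (cls r x) (Var p) <-> sat x (Var p));
  filtr_min : forall e x y, rmin r e x y -> R e (cls r x) (cls r y);
  filtr_max : forall e x y, R e (cls r x) (cls r y) -> rmax G e x y
}.

Definition definable r : Prop :=
  exists P, finite_set P /\ forall x y, r x y <-> fm_equiv P x y.

End Filtration.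

Definition admits_definable_filtration S (C : model S -> Prop) : Prop :=
  forall G : set (fm S), finite_set G -> sub_closed G ->
  forall M, C M ->
  exists (r : world M -> world M -> Prop)
         (R : S -> quot r -> quot r -> Prop) (V : nat -> quot r -> Prop),
    [/\ is_filtration G R V, definable r & C (quot_model R V)].

(** * The PDL-like expansion *)

Inductive sharp (S : Type) : Type :=
  | Base of S
  | Seqc of S & S
  | Union of S & S
  | Plus of S.

Section SharpFinite.
Variable S : Type.

Definition sharp_enc (e : sharp S) : S + (S * S) + (S * S) + S :=
  match e with
  | Base a => inl (inl (inl a))
  | Seqc a b => inl (inl (inr (a, b)))
  | Union a b => inl (inr (a, b))
  | Plus a => inr a
  end.

Definition sharp_dec (u : S + (S * S) + (S * S) + S) : sharp S :=
  match u with
  | inl (inl (inl a)) => Base a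
  | inl (inl (inr (a, b))) => Seqc a b
  | inl (inr (a, b)) => Union a b
  | inr a => Plus a
  end.

Lemma sharp_encK : cancel sharp_enc sharp_dec. Proof. by case. Qed.

End SharpFinite.

HB.instance Definition _ (S : finType) :=
  Finite.copy (sharp S) (can_type (@sharp_encK S)).

Fixpoint rename S T (f : S -> T) (phi : fm S) : fm T :=
  match phi with
  | Bot => Bot
  | Var i => Var i
  | Imp a b => Imp (rename f a) (rename f b)
  | Box e a => Box (f e) (rename f a)
  end.

Definition sharp_axioms (S : Type) : set (fm (sharp S)) :=
  let p := Var 0 in
  [set phi | exists e c : S,
    [\/ phi = Iff (Box (Union e c) p) (And (Box (Base e) p) (Box (Base c) p)),
        phi = Iff (Box (Seqc e c) p) (Box (Base e) (Box (Base c) p)) |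
        [\/ phi = Imp (Box (Plus e) p) (Box (Base e) p),
            phi = Imp (Box (Plus e) p) (Box (Base e) (Box (Plus e) p)) |
            phi = Imp (Box (Plus e) (Imp p (Box (Base e) p)))
                      (Imp (Box (Base e) p) (Box (Plus e) p))]]].

Definition sharp_logic S (L : set (fm S)) : set (fm (sharp S)) :=
  least_logic ([set rename (@Base S) phi | phi in L] `|` @sharp_axioms S).

Fixpoint sharp_iter (S : finType) (n : nat) : finType :=
  match n with
  | 0 => S
  | n'.+1 => sharp (sharp_iter S n') : finType
  end.

Fixpoint logic_iter (S : finType) (L : set (fm S)) (n : nat) :
    set (fm (sharp_iter S n)) :=
  match n return set (fm (sharp_iter S n)) with
  | 0 => L
  | n'.+1 => sharp_logic (@logic_iter S L n')
  end.
Arguments logic_iter {S} L n.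

(** * Computability *)

(* Codes of the partial mu-recursive functions, indexed by their arity. *)
Inductive recf : nat -> Type :=
  | Zero n : recf n
  | Succ : recf 1
  | Proj n : 'I_n -> recf n
  | Compose n m : recf m -> ('I_m -> recf n) -> recf n
  | PrimRec n : recf n -> recf n.+2 -> recf n.+1
  | Mu n : recf n.+1 -> recf n.

(* [computes c xs y]: the function coded by [c] is defined at [xs], with value
   [y]; this is meaningful when the length of [xs] is the arity of [c].  The
   recursion variable and the variable minimised over come first; in the step of
   a primitive recursion, the arguments are the predecessor, the previous value
   and the parameters. *)
Fixpoint computes n (c : recf n) (xs : seq nat) (y : nat) : Prop :=
  match c with
  | Zero _ => y = 0
  | Succ => y = (head 0 xs).+1
  | Proj _ i => y = nth 0 xs i
  | Compose _ m f g =>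
      exists zs : seq nat,
        [/\ size zs = m, forall i : 'I_m, computes (g i) xs (nth 0 zs i)
          & computes f zs y]
  | PrimRec _ f g =>
      (fix loop (k v : nat) : Prop :=
        match k with
        | 0 => computes f (behead xs) v
        | k'.+1 =>
            exists2 u, loop k' u & computes g [:: k', u & behead xs] v
        end) (head 0 xs) y
  | Mu _ f =>
      computes f (y :: xs) 0 /\
      forall z, z < y -> exists v, computes f (z :: xs) v.+1
  end.

(* For a set of objects coded by natural numbers, only the behaviour of the
   algorithm on codes matters. *)
Definition decidable_set T (code : T -> nat) (A : set T) : Prop :=
  exists c : recf 1, forall x,
    (A x -> computes c [:: code x] 1) /\
    (~ A x -> computes c [:: code x] 0).

Definition re_set T (code : T -> nat) (A : set T) : Prop :=
  exists c : recf 1, forall x, A x <-> exists y, computes c [:: code x] y.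

Definition co_re_set T (code : T -> nat) (A : set T) : Prop :=
  re_set code (~` A).

(* Cantor pairing *)
Definition code_pair (x y : nat) : nat := 'C((x + y).+1, 2) + y.

Fixpoint code_seq (s : seq nat) : nat :=
  if s is x :: s' then (code_pair x (code_seq s')).+1 else 0.

Definition code_fin (T : finType) (x : T) : nat := enum_rank x.

Fixpoint code_fm (S : finType) (phi : fm S) : nat :=
  match phi with
  | Bot => code_pair 0 0
  | Var i => code_pair 1 i
  | Imp a b => code_pair 2 (code_pair (code_fm a) (code_fm b))
  | Box e a => code_pair 3 (code_pair (code_fin e) (code_fm a))
  end.

(* A finite frame, given by its number of points (minus one) and the list of its
   labelled arrows; up to isomorphism, every finite frame arises in this way. *)
Record finite_presentation (S : Type) := FinitePresentation {
  fp_pred_card : nat;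
  fp_arrows : seq (S * 'I_fp_pred_card.+1 * 'I_fp_pred_card.+1)
}.

Definition presented_frame (S : finType) (D : finite_presentation S) : frame S :=
  Frame (inhabits (ord0 : 'I_(fp_pred_card D).+1))
        (fun e (i j : 'I_(fp_pred_card D).+1) => (e, i, j) \in fp_arrows D).

Definition code_arrow (S : finType) n (a : S * 'I_n * 'I_n) : nat :=
  let: (e, i, j) := a in code_pair (code_fin e) (code_pair i j).

Definition code_presentation (S : finType) (D : finite_presentation S) : nat :=
  code_pair (fp_pred_card D)
    (code_seq [seq code_arrow a | a <- fp_arrows D]).

Definition finite_frames_decidable (S : finType) (L : set (fm S)) : Prop :=
  decidable_set (@code_presentation S) [set D | frame_of L (presented_frame D)].

(* Main.v *)
Require Import Defs.
From mathcomp Require Import all_boot.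
From mathcomp Require Import boolp classical_sets functions cardinality.
From Corelib Require Import RelationClasses.
From Stdlib Require List.
From Stdlib Require Import Relation_Operators Operators_Properties.

Set Implicit Arguments.
Unset Strict Implicit.
Unset Printing Implicit Defensive.

Local Open Scope classical_set_scope.

(** Everything rests on a strengthening of the hypothesis on [L]: a model of [L] has
    a definable filtration whose frame, and not only the model on it, validates [L].
    It is got from the given filtration by identifying the points that satisfy the
    same formulas ([filtration_frame_of]). This preserves truth, and since the
    quotient is finite and its points are told apart by formulas, each of its subsets
    is defined by a formula; so a theorem of [L] holds under every valuation, being
    the instance of another theorem.

    For the expansion of [L], the truth sets of the relevant formulas of a model [M]
    are named by fresh variables; the basic relations of [M] then carry a model of
    [L], which is filtrated as above. On the quotient, compositions, unions and
    transitive closures are interpreted literally, so that its frame validates the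
    new axioms. The compound relations of [M] itself are not assumed to be standard.
    Nevertheless their projections lie in those of the quotient ([sharp_min]),
    because sets of classes are definable in [M] and the axioms, in particular
    induction, may be applied to the formulas defining them; and the upper bound
    ([sharp_max]) only needs a modality to be unfolded by one step. The construction
    can be repeated ([sharp_admits_filtration]). Together with canonical models,
    filtration gives the finite model property ([finite_countermodel]).

    As to computability, a frame of the expanded logic is one whose reduct is a frame
    of [L] and that validates finitely many further formulas. Decidability of the
    class of finite frames is therefore inherited by the expansion
    ([sharp_frames_decidable]), and non-theorems are found by searching for a finite
    countermodel ([co_re_logic]). If [L] is finitely axiomatizable, so are its
    expansions; their finite frames can be recognised by evaluating the axioms, their
    theorems can be enumerated by a machine that runs through derivations
    ([derivable_search]), and the two searches together decide the logic. The
    programs are obtained from a calculus of computable functions between types with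
    numerical codes ([computable]), in which sequences and formulas can be folded. *)

(** * Sequences and finite types *)

Lemma mem_In (T : eqType) (x : T) s : x \in s <-> List.In x s.
Proof.
elim: s => //= y s IH; rewrite in_cons; split=> [/orP[/eqP->|/IH]|[->|/IH xs]].
- by left.
- by right.
- by rewrite eqxx.
- by rewrite xs orbT.
Qed.

Lemma In_enum (T : finType) (x : T) : List.In x (enum T).
Proof. by apply/mem_In; rewrite mem_enum. Qed.

(** * Hilbert systems and maximal consistent sets *)

Section Lindenbaum.
Variable S : Type.
Implicit Types (a b phi : fm S) (H U : set (fm S)).

Record prop_theory H : Prop := PropTheory {
  pt_k : forall a b, H (Imp a (Imp b a));
  pt_s : forall a b c,
    H (Imp (Imp a (Imp b c)) (Imp (Imp a b) (Imp a c)));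
  pt_dn : forall a, H (Imp (Neg (Neg a)) a);
  pt_mp : forall a b, H (Imp a b) -> H a -> H b
}.

(** Such a set is at once a maximal consistent theory and a classical valuation
    of the formulas that makes exactly its members true. *)
Record boolean U : Prop := Boolean {
  bool_bot : ~ U Bot;
  bool_imp : forall a b, U (Imp a b) <-> (U a -> U b)
}.

Lemma prop_theory_id H a : prop_theory H -> H (Imp a a).
Proof.
case=> k s _ mp; apply: (mp (Imp a (Imp a a))); last exact: k.
by apply: (mp _ _ (s _ _ _) (k a (Imp a a))).
Qed.

(** The deduction theorem: closing [H] under an extra hypothesis [a] amounts to
    collecting the consequents of [a] in [H]. *)
Lemma prop_theory_adjoin H a :
  prop_theory H -> prop_theory [set b | H (Imp a b)].
Proof.
case=> k s dn mp; split=> /= [b c|b c d|b|b c Hbc Hb].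
- exact: (mp _ _ (k _ _) (k _ _)).
- exact: (mp _ _ (k _ _) (s _ _ _)).
- exact: (mp _ _ (k _ _) (dn _)).
- exact: (mp _ _ (mp _ _ (s _ _ _) Hbc) Hb).
Qed.

Lemma sub_adjoin H a : prop_theory H -> H `<=` [set b | H (Imp a b)].
Proof. by move=> pH b Hb; exact: (pt_mp pH (pt_k pH _ _)). Qed.

Lemma maximal_boolean U : prop_theory U -> ~ U Bot ->
  (forall U', prop_theory U' -> U `<=` U' -> ~ U' Bot -> U' `<=` U) ->
  boolean U.
Proof.
move=> pU Ubot maxU.
have negU a : ~ U a -> U (Neg a).
  move=> Ua; apply: contrapT => nUna.
  apply: Ua; apply: (maxU [set b | U (Imp a b)]) => //.
  - exact: prop_theory_adjoin.
  - exact: sub_adjoin.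
  - exact: prop_theory_id.
split=> // a b; split=> [Uab Ua|UaUb]; first exact: (pt_mp pU Uab).
have [Ua|nUa] := pselect (U a).
  by apply: (pt_mp pU (pt_k pU _ _)); exact: UaUb.
have pUa := prop_theory_adjoin a pU.
apply: (pt_mp pUa (pt_dn pUa b)).
apply: (pt_mp pUa (pt_k pUa _ _)); exact: negU.
Qed.

(** Adding [Neg phi] to [H] keeps it consistent, so Zorn's lemma yields a maximal
    consistent extension that omits [phi]. *)
Lemma lindenbaum H phi : prop_theory H -> ~ H phi ->
  exists U, [/\ boolean U, H `<=` U & ~ U phi].
Proof.
move=> pH nHphi; pose H' : set (fm S) := [set b | H (Imp (Neg phi) b)].
have pH' : prop_theory H' by exact: prop_theory_adjoin.
have H'bot : ~ H' Bot by move/(pt_mp pH (pt_dn pH phi)).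
(* The empty set is admitted so that the union of the empty chain qualifies. *)
pose P U := U = set0 \/ [/\ H' `<=` U, prop_theory U & ~ U Bot].
have chainP F : F `<=` P -> total_on F subset -> P (\bigcup_(X in F) X).
  move=> FP totF.
  have [[X0 FX0 X0n0]|allF0] := pselect (exists2 X, F X & X <> set0); last first.
    left; apply/seteqP; split=> // a [X FX Xa].
    by apply: allF0; exists X => // X0; rewrite X0 in Xa.
  have good X a : F X -> X a -> [/\ H' `<=` X, prop_theory X & ~ X Bot].
    by move=> /FP[->|].
  have [sHX0 pX0 _] : [/\ H' `<=` X0, prop_theory X0 & ~ X0 Bot].
    by case: (FP _ FX0).
  right; split.
  - by move=> a /sHX0 X0a; exists X0.
  - split=> [a b|a b c|a|a b].
    + by exists X0 => //; exact: pt_k.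
    + by exists X0 => //; exact: pt_s.
    + by exists X0 => //; exact: pt_dn.
    + move=> [X FX Xab] [Y FY Ya].
      have [XY|YX] := totF _ _ FX FY.
        by exists Y => //; have [_ pY _] := good _ _ FY Ya; apply: pt_mp Ya => //;
          exact: XY.
      by exists X => //; have [_ pX _] := good _ _ FX Xab; apply: pt_mp Xab _ => //;
        exact: YX.
  - by move=> [X FX Xbot]; case: (good _ _ FX Xbot).
have [U [PU maxU]] := Zorn_bigcup chainP.
have PH' : P H' by right; split.
have [sHU pU Ubot] : [/\ H' `<=` U, prop_theory U & ~ U Bot].
  case: PU => // U0; exfalso; apply: (maxU H') => //.
  by rewrite U0; split=> // /(_ _ (pt_k pH' Bot Bot)).
have bU : boolean U.
  apply: maximal_boolean => // U' pU' sUU' U'bot a U'a; apply: contrapT => nUa.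
  apply: (maxU U'); first by split=> // /(_ _ U'a).
  by right; split=> //; exact: subset_trans sUU'.
exists U; split=> //; first by move=> a Ha; apply: sHU; exact: sub_adjoin.
move=> Uphi; have Unphi : U (Neg phi) by apply: sHU; exact: prop_theory_id.
by move/(bool_imp bU): Unphi => /(_ Uphi) /(bool_bot bU).
Qed.

Lemma boolean_prop_eval U phi : boolean U ->
  prop_eval (fun a => `[< U a >]) phi <-> U phi.
Proof.
move=> bU; elim: phi => [|i|a IHa b IHb|e a _] /=.
- by split=> // /(bool_bot bU).
- by split=> /asboolP.
- rewrite (bool_imp bU); split=> [/implyP Uab /IHa /Uab /IHb //|Uab].
  by apply/implyP => /IHa /Uab /IHb.
- by split=> /asboolP.
Qed.

(** Completeness of the three schemata for classical propositional logic: a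
    formula that they do not prove is false under the valuation given by some
    maximal consistent set. *)
Lemma prop_theory_taut H phi : prop_theory H -> tautology phi -> H phi.
Proof.
move=> pH taut; apply: contrapT => /(lindenbaum pH)[U [bU _]]; apply.
exact/(boolean_prop_eval phi bU)/taut.
Qed.

Lemma logic_prop_theory L : is_logic L -> prop_theory L.
Proof.
move=> [taut _ mp _ _]; split=> // [a b|a b c|a]; apply: taut => v /=.
- by case: (prop_eval v a); case: (prop_eval v b).
- by case: (prop_eval v a); case: (prop_eval v b); case: (prop_eval v c).
- by case: (prop_eval v a).
Qed.

End Lindenbaum.

Section HilbertCalculus.
Variable S : finType.
Implicit Types (phi a b : fm S) (X : seq (fm S)).

Definition hilbert_axioms X : seq (fm S) :=
  let p := Var 0 in let q := Var 1 in let r := Var 2 in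
  [:: Imp p (Imp q p),
      Imp (Imp p (Imp q r)) (Imp (Imp p q) (Imp p r)),
      Imp (Neg (Neg p)) p
    & [seq axiomK e | e <- enum S] ++ X].

(** Substitution is confined to axioms, and they are finitely many: this is what
    makes derivations easy to enumerate. *)
Inductive derivable X : set (fm S) :=
  | der_axiom s i : i < size (hilbert_axioms X) ->
      derivable X (subst s (nth Bot (hilbert_axioms X) i))
  | der_mp a b : derivable X (Imp a b) -> derivable X a -> derivable X b
  | der_nec e a : derivable X a -> derivable X (Box e a).

End HilbertCalculus.

Lemma subst_subst S (s t : nat -> fm S) phi :
  subst s (subst t phi) = subst (fun i => subst s (t i)) phi.
Proof. by elim: phi => //= [a -> b ->|e a ->]. Qed.

Lemma subst_var S (phi : fm S) : subst Var phi = phi.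
Proof. by elim: phi => //= [a -> b ->|e a ->]. Qed.

Lemma least_logic_sub S (X : set (fm S)) : X `<=` least_logic X.
Proof. by move=> a Xa L _; apply. Qed.

Lemma least_logic_logic S (X : set (fm S)) : is_logic (least_logic X).
Proof.
split.
- by move=> a ta L HL _; exact: logic_taut.
- by move=> e L HL _; exact: logic_K.
- by move=> a b Lab La L HL XL; apply: (logic_mp HL (Lab _ HL XL)); exact: La.
- by move=> s a La L HL XL; apply: (logic_subst HL); exact: La.
- by move=> e a La L HL XL; apply: (logic_nec HL); exact: La.
Qed.

Section HilbertCompleteness.
Variable S : finType.
Implicit Types (phi a b : fm S) (X : seq (fm S)).

Lemma fm_index (l : seq (fm S)) phi : List.In phi l ->
  exists2 i, i < size l & nth Bot l i = phi.
Proof.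
elim: l => //= a l IH [->|/IH[i il <-]]; first by exists 0.
by exists i.+1.
Qed.

Lemma der_instance X s phi : List.In phi (hilbert_axioms X) ->
  derivable X (subst s phi).
Proof. by case/fm_index => i iX <-; exact: der_axiom. Qed.

Lemma in_axiomK e X : List.In (axiomK e) (hilbert_axioms X).
Proof.
by do 3!right; apply/List.in_or_app; left; apply/List.in_map/In_enum.
Qed.

Lemma derivable_prop_theory X : prop_theory (derivable X).
Proof.
split=> [a b|a b c|a|a b]; last exact: der_mp.
- by apply: (@der_instance X (nth Bot [:: a; b])
    (Imp (Var 0) (Imp (Var 1) (Var 0)))); left.
- apply: (@der_instance X (nth Bot [:: a; b; c])
    (Imp (Imp (Var 0) (Imp (Var 1) (Var 2)))
         (Imp (Imp (Var 0) (Var 1)) (Imp (Var 0) (Var 2))))).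
  by right; left.
- apply: (@der_instance X (nth Bot [:: a]) (Imp (Neg (Neg (Var 0))) (Var 0))).
  by do 2!right; left.
Qed.

Lemma derivable_logic X : is_logic (derivable X).
Proof.
split.
- by move=> phi; exact: prop_theory_taut (derivable_prop_theory X).
- by move=> e; rewrite -(subst_var (axiomK e)); apply/der_instance/in_axiomK.
- by move=> a b; exact: der_mp.
- move=> s a; elim=> [t i iX|{}a b _ IHab _ IHa|e {}a _ IHa] /=.
  + by rewrite subst_subst; exact: der_axiom.
  + exact: der_mp IHab IHa.
  + exact: der_nec.
- by move=> e a; exact: der_nec.
Qed.

Lemma derivableE X : derivable X = least_logic [set phi | List.In phi X].
Proof.
apply/seteqP; split=> phi; last first.
  apply; first exact: derivable_logic.
  move=> a Xa; rewrite -(subst_var a); apply: der_instance.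
  by do 3!right; apply/List.in_or_app; right.
move=> dphi L HL XL; have pL := logic_prop_theory HL.
elim: dphi => [s i iX|a b _ Lab _ La|e a _ La]; last 2 first.
- exact: logic_mp La.
- exact: logic_nec.
apply: (logic_subst HL).
have: List.In (nth Bot (hilbert_axioms X) i) (hilbert_axioms X).
  elim: (hilbert_axioms X) i iX => //= a l IH [|i] il; [by left|right; exact: IH].
case=> [<-|[<-|[<-|]]]; [exact: pt_k|exact: pt_s|exact: pt_dn|].
by move/(@List.in_app_or _ _ _ _)=> [/List.in_map_iff[e [<- _]]|/XL //]; exact: logic_K.
Qed.

End HilbertCompleteness.

(** * Canonical models *)

Section Semantics.
Variable S : Type.
Implicit Types (M : model S) (F : frame S) (a b phi : fm S).

Lemma sat_And M (x : world M) a b : sat x (And a b) <-> sat x a /\ sat x b.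
Proof.
split=> /= [nab|[xa xb]]; last by apply.
by split; apply: contrapT => nx; apply: nab => xa // /nx.
Qed.

Lemma sat_Iff M (x : world M) a b :
  sat x (Iff a b) <-> (sat x a <-> sat x b).
Proof. by rewrite /Iff sat_And. Qed.

Lemma sat_subst M (s : nat -> fm S) (x : world M) phi :
  sat x (subst s phi) <->
  sat (M := Model (fun i (y : world M) => sat y (s i))) x phi.
Proof.
elim: phi x => //= [a IHa b IHb|e a IHa] x.
  by rewrite IHa IHb.
by split=> H y /H /IHa.
Qed.

Lemma eq_sat F (V V' : nat -> world F -> Prop) (x : world F) phi :
  (forall i y, V i y <-> V' i y) ->
  sat (M := Model V) x phi <-> sat (M := Model V') x phi.
Proof.
move=> VV'; suff -> : V = V' by [].
by apply/funext => i; apply/funext => y; exact/propext.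
Qed.

Lemma prop_eval_sat M (x : world M) phi :
  prop_eval (fun a => `[< sat x a >]) phi <-> sat x phi.
Proof.
elim: phi => [|i|a IHa b IHb|e a _] //=; try by split=> /asboolP.
by rewrite -IHa -IHb; split=> /implyP.
Qed.

Lemma frame_valid_logic F : is_logic (frame_valid F).
Proof.
split=> [phi taut|e|a b Fab Fa|s a Fa|e a Fa] V x /=.
- exact/prop_eval_sat/taut.
- by move=> xab xa y xy; exact: xab xy (xa y xy).
- exact: Fab (Fa V x).
- by apply/sat_subst; exact: Fa.
- by move=> y _; exact: Fa.
Qed.

Lemma frame_of_least_logic F (X : set (fm S)) :
  frame_of (least_logic X) F <-> X `<=` frame_valid F.
Proof.
split=> [FX a Xa|XF a]; first by apply: FX; exact: least_logic_sub.
by apply=> //; exact: frame_valid_logic.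
Qed.

End Semantics.

Section CanonicalModel.
Variables (S : Type) (L : set (fm S)).
Hypothesis L_logic : is_logic L.
Implicit Types (a b phi : fm S).

Definition ultra : Type := {U : set (fm S) | boolean U /\ L `<=` U}.

Definition canonical_model (W0 : inhabited ultra) : model S :=
  @Model S (@Frame S ultra W0
      (fun e U V => forall a, sval U (Box e a) -> sval V a))
    (fun i U => sval U (Var i)).

(** The formulas necessary at a point form a theory, to which Lindenbaum's lemma is
    applied to find a successor refuting a formula that is not necessary. *)
Lemma box_prop_theory (U : ultra) e :
  prop_theory [set a | sval U (Box e a)].
Proof.
have pL := logic_prop_theory L_logic.
case: U => U /= [bU LU].
have nec a : L a -> U (Box e a) by move=> La; apply: LU; exact: (logic_nec L_logic).
split=> [a b|a b c|a|a b] /=.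
- exact/nec/(pt_k pL).
- exact/nec/(pt_s pL).
- exact/nec/(pt_dn pL).
- move=> Uab Ua; have := logic_subst L_logic (nth Bot [:: a; b]) (logic_K L_logic e).
  by move/LU/(bool_imp bU)/(_ Uab)/(bool_imp bU)/(_ Ua).
Qed.

Lemma canonical_truth W0 (U : world (canonical_model W0)) phi :
  sat U phi <-> sval U phi.
Proof.
elim: phi U => [|i|a IHa b IHb|e a IHa] U //=.
- by split=> //; case: U => U [[nbot _] _] /nbot.
- rewrite IHa IHb; case: U => U [[_ bimp] _] /=; exact: iff_sym (bimp a b).
- split=> [Ua|Ua V /(_ _ Ua) /IHa //].
  apply: contrapT => /(lindenbaum (box_prop_theory U e))[V [bV UV]]; apply.
  have LV : L `<=` V.
    move=> b Lb; apply: UV => /=; case: U {Ua} => U [_ LU] /=.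
    by apply: LU; exact: (logic_nec L_logic).
  exact/(IHa (exist _ V (conj bV LV)))/Ua.
Qed.

(** The points of the canonical model satisfy exactly their members, hence all of [L];
    by Lindenbaum's lemma some point omits [phi]. *)
Lemma logic_countermodel phi : ~ L phi ->
  exists M : model S, Mod L M /\ exists x : world M, ~ sat x phi.
Proof.
move=> /(lindenbaum (logic_prop_theory L_logic))[U [bU LU nUphi]].
pose U0 : ultra := exist _ U (conj bU LU).
exists (canonical_model (inhabits U0)); split.
  by move=> a La V; apply/canonical_truth; case: V => V [_ LV] /=; exact: LV.
by exists U0 => /canonical_truth.
Qed.

End CanonicalModel.

(** * Filtrations onto frames of the logic *)

Section FiniteLists.
Variable T : Type.

Lemma finite_set_list (A : set T) : finite_set A ->
  exists l : seq T, forall x, List.In x l <-> A x.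
Proof.
elim/Pchoice: T A => U A /finite_seqP[l ->]; exists l => x.
exact: iff_sym (mem_In x l).
Qed.

Lemma list_finite_set (l : seq T) (A : set T) :
  (forall x, A x -> List.In x l) -> finite_set A.
Proof.
move=> Al; apply: (@sub_finite_set _ _ [set x | List.In x l]) => //.
elim: l {A Al} => /= [|y l IH].
  by apply: (@sub_finite_set _ _ set0); [move=> x|exact: finite_set0].
apply: (@sub_finite_set _ _ ([set y] `|` [set x | List.In x l])).
  by move=> x [->|xl]; [left|right].
by rewrite finite_setU; split=> //; exact: finite_set1.
Qed.

End FiniteLists.

Section Definability.
Variables (S : Type) (M : model S).
Implicit Types (r : world M -> world M -> Prop) (C : world M -> Prop).

Definition agree (l : seq (fm S)) (x y : world M) : Prop :=
  forall phi, List.In phi l -> (sat x phi <-> sat y phi).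

Definition definable_set C : Prop := exists psi, forall x, sat x psi <-> C x.

(** By induction on [l]: split [C] according to the truth value of the first
    formula; both halves, saturated for the others, are definable. *)
Lemma saturated_definable (l : seq (fm S)) C :
  (forall x y, agree l x y -> C x -> C y) -> definable_set C.
Proof.
elim: l C => [|phi l IH] C satC.
  have [[x Cx]|nC] := pselect (exists x, C x).
    by exists (Imp Bot Bot) => y /=; split=> // _; apply: satC Cx.
  by exists Bot => y /=; split=> // Cy; apply: nC; exists y.
pose half (P : world M -> Prop) x := exists y, [/\ agree l y x, P y & C y].
have half_def P : definable_set (half P).
  apply: IH => x y xy [z [zx Pz Cz]]; exists z; split=> // a al.
  by rewrite (zx a al); exact: xy.
have [psi1 psi1P] := half_def (fun x => sat x phi).
have [psi0 psi0P] := half_def (fun x => ~ sat x phi).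
exists (And (Imp phi psi1) (Imp (Neg phi) psi0)) => x.
have cons_agree y : agree l y x -> (sat y phi <-> sat x phi) ->
    agree (phi :: l) y x by move=> yx eqphi a [<-|/yx].
rewrite sat_And; split=> [[x1 x0]|Cx].
  have [xphi|nxphi] := pselect (sat x phi).
    have /psi1P[y [yx yphi Cy]] := x1 xphi.
    by apply: satC Cy; apply: cons_agree.
  have /psi0P[y [yx nyphi Cy]] := x0 nxphi.
  by apply: satC Cy; apply: cons_agree.
by split=> /= h; [apply/psi1P|apply/psi0P]; exists x.
Qed.

End Definability.

Section Quotients.
Variables (W : Type) (r : W -> W -> Prop).
Hypothesis r_equiv : Equivalence r.

Lemma eq_cls x y : cls r x = cls r y <-> r x y.
Proof.
split=> [[] rxy|rxy].
  by change (r x y); rewrite rxy; exact: Equivalence_Reflexive.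
apply: eq_exist; apply/funext => z; apply/propext.
split; apply: Equivalence_Transitive => //; exact: Equivalence_Symmetric.
Qed.

Lemma cls_surj (C : quot r) : exists x, C = cls r x.
Proof. by case: C => C [x Cx]; exists x; apply: eq_exist. Qed.

End Quotients.

Section DefinableQuotient.
Variables (S : Type) (M : model S) (r : world M -> world M -> Prop).
Hypotheses (r_equiv : Equivalence r) (r_fin : finite_set [set: quot r]).

Lemma definable_classes :
  (forall C : quot r, definable_set (fun x => C = cls r x)) -> definable r.
Proof.
move=> /choice[D DP]; have [l lP] := finite_set_list r_fin.
exists [set D C | C in [set: quot r]]; split; first exact: finite_image.
move=> x y; split=> [/(eq_cls r_equiv) rxy _ [C _ <-]|xy].
  by rewrite !DP rxy.
apply/(eq_cls r_equiv); apply/DP/xy; first by exists (cls r x).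
exact/DP.
Qed.

(** Points of the same class agree on the finitely many formulas that define [r]. *)
Lemma definable_saturated C : definable r ->
  (forall x y, r x y -> C x -> C y) -> definable_set C.
Proof.
move=> [P [/finite_set_list[l lP] rP]] satC; apply: (@saturated_definable _ _ l).
move=> x y xy; apply: satC; apply/rP => phi /lP; exact: xy.
Qed.

End DefinableQuotient.

Section FilteredFrames.
Variables (S : Type).
Implicit Types (G : set (fm S)) (L : set (fm S)).

Section TruthLemma.
Variables (M : model S) (G : set (fm S)) (r : world M -> world M -> Prop).
Variables (R : S -> quot r -> quot r -> Prop) (V : nat -> quot r -> Prop).
Hypotheses (G_sub : sub_closed G) (filtr : is_filtration G R V).

Lemma subformula_refl (phi : fm S) : subformula phi phi.
Proof. by case: phi => *; left. Qed.

Lemma filtration_truth phi (x : world M) : G phi ->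
  sat (M := quot_model R V) (cls r x) phi <-> sat x phi.
Proof.
have clsP := cls_surj (r := r); have rE := filtr_equiv filtr.
elim: phi x => [|i|a IHa b IHb|e a IHa] x Gphi //.
- exact: (filtr_val filtr).
- have Ga : G a by apply: G_sub Gphi _; right; left; exact: subformula_refl.
  have Gb : G b by apply: G_sub Gphi _; right; right; exact: subformula_refl.
  by rewrite /= -/(sat _ _) IHa ?IHb.
- have Ga : G a by apply: G_sub Gphi _; right; exact: subformula_refl.
  split=> /= xa.
    move=> y xy; rewrite -IHa //; apply: xa.
    by apply: (filtr_min filtr); exists x, y; split=> //; exact: Equivalence_Reflexive.
  move=> C; have [y ->] := clsP C => xy; rewrite IHa //.
  exact: (filtr_max filtr xy Gphi xa).
Qed.

End TruthLemma.

(** The quotient of a model by full modal equivalence satisfies the same formulas.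
    If it is finite, its points are told apart by finitely many formulas, so all
    sets of points are definable, and a logic true in the model is valid on the
    frame of its quotient. *)
Section ModalEquivalence.
Variables (M : model S) (W : Type) (f : W -> world M).
Hypothesis f_surj : forall u, exists x, u = f x.
Hypothesis M_fin : finite_set [set: world M].

Definition meq (x y : W) : Prop :=
  forall phi, sat (f x) phi <-> sat (f y) phi.

Local Notation r := meq.

Definition meq_acc e (C C' : quot r) : Prop :=
  exists x y, [/\ C = cls r x, C' = cls r y & acc e (f x) (f y)].

Definition meq_val i (C : quot r) : Prop :=
  exists2 x, C = cls r x & Defs.val i (f x).

Lemma meq_equiv : Equivalence r.
Proof.
split=> [x phi|x y xy phi|x y z xy yz phi] //; first by rewrite xy.
by rewrite xy.
Qed.

Definition meq_model (W0 : inhabited W) : model S :=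
  @Model S (Frame (quot_inhabited r W0) meq_acc) meq_val.

Lemma meq_truth W0 phi x :
  sat (M := meq_model W0) (cls r x) phi <-> sat (f x) phi.
Proof.
have clsE := eq_cls meq_equiv.
elim: phi x => [|i|a IHa b IHb|e a IHa] x //=.
- split=> [[y /clsE xy yi]|xi]; last by exists x.
  exact/(xy (Var i)).
- by rewrite IHa IHb.
- split=> xa.
    move=> u xu; have [y uy] := f_surj u; subst u.
    by rewrite -IHa; apply: xa; exists x, y.
  move=> C [x' [y [/clsE xx' -> x'y]]]; rewrite IHa.
  by move/(xx' (Box e a)): xa; apply.
Qed.

Lemma meq_finite : finite_set [set: quot r].
Proof.
have [l lP] := finite_set_list M_fin.
have [g gK] := choice f_surj.
apply: (@list_finite_set _ [seq cls r (g u) | u <- l]) => C _.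
have [x ->] := cls_surj C; apply/List.in_map_iff; exists (f x); split.
  by apply/eq_cls; [exact: meq_equiv|move=> phi; rewrite -gK].
exact/lP.
Qed.

Lemma meq_definable W0 (C : quot r -> Prop) :
  definable_set (M := meq_model W0) C.
Proof.
have [l lP] := finite_set_list meq_finite.
have sep (uv : quot r * quot r) : exists phi, uv.1 <> uv.2 ->
    ~ (sat (M := meq_model W0) uv.1 phi <-> sat (M := meq_model W0) uv.2 phi).
  case: uv => u v /=; have [->|uv] := pselect (u = v); first by exists Bot.
  have [x ux] := cls_surj u; have [y vy] := cls_surj v; subst u v.
  have nxy : ~ r x y by move=> /(eq_cls meq_equiv).
  have [phi xy] : exists phi, ~ (sat (f x) phi <-> sat (f y) phi).
    by apply: contrapT => nE; apply: nxy => phi; apply: contrapT => ?; apply: nE;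
      exists phi.
  by exists phi => _; rewrite !meq_truth.
have [d dP] := choice sep.
apply: (@saturated_definable _ (meq_model W0)
  [seq d uv | uv <- List.list_prod l l]) => u v uv Cu.
suff <- : u = v by [].
apply: contrapT => /(dP (u, v)) /=; apply; apply: uv.
by apply/List.in_map; apply/List.in_prod; exact/lP.
Qed.

Lemma meq_frame_of W0 L : is_logic L -> Mod L M -> frame_of L (meq_model W0).
Proof.
move=> HL ML phi Lphi V.
have [s sP] := choice (fun i => meq_definable W0 (V i)).
move=> u; have [x ->] := cls_surj u.
have : sat (M := meq_model W0) (cls r x) (subst s phi).
  by rewrite meq_truth; apply: ML; exact: logic_subst.
rewrite sat_subst => h.
exact: (proj1 (eq_sat _ _ (fun i y => sP i y)) h).
Qed.

End ModalEquivalence.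

(** Merging the points of a filtration that satisfy the same formulas keeps it within
    the bounds [rmin] and [rmax], and the classes remain definable as unions of
    definable classes. *)
Lemma filtration_frame_of L : is_logic L ->
  admits_definable_filtration (Mod L) ->
  forall G, finite_set G -> sub_closed G -> forall M, Mod L M ->
  exists (r : world M -> world M -> Prop)
         (R : S -> quot r -> quot r -> Prop) (V : nat -> quot r -> Prop),
    [/\ is_filtration G R V, definable r & frame_of L (quot_model R V)].
Proof.
move=> HL filtrL G finG subG M ML.
have [r0 [R0 [V0 [filtr0 def0 ML0]]]] := filtrL G finG subG M ML.
have r0E := filtr_equiv filtr0.
pose M0 := quot_model R0 V0; pose f : world M -> world M0 := cls r0.
have f_surj u : exists x, u = f x by exact: cls_surj.
have finM0 : finite_set [set: world M0] := filtr_finite filtr0.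
pose r := meq f.
have rE : Equivalence r := meq_equiv f.
have r0r x y : r0 x y -> r x y.
  by move=> /(eq_cls r0E) xy phi; rewrite /f xy.
exists r, (@meq_acc M0 _ f), (@meq_val M0 _ f); split; last first.
- exact: meq_frame_of f_surj finM0 (world_inhabited M) _ HL ML0.
- apply: definable_classes => //; first exact: meq_finite f_surj finM0.
  move=> C; apply: definable_saturated def0 _ => x y /r0r rxy ->.
  exact/eq_cls.
split=> //.
- exact: meq_finite f_surj finM0.
- move=> x y rxy phi Gphi.
  by rewrite -!(filtration_truth subG filtr0 _ Gphi).
- move=> p x Gp.
  have /= <- := filtration_truth subG filtr0 x Gp.
  exact: (meq_truth f_surj (world_inhabited M) (Var p)).
- move=> e x y [x' [y' [xx' yy' x'y']]].
  exists x', y'; split; try exact/eq_cls.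
  apply: (filtr_min filtr0); exists x', y'; split=> //; exact: Equivalence_Reflexive.
- move=> e x y [x' [y' [/(eq_cls rE) xx' /(eq_cls rE) yy' x'y']]] phi Gphi xphi.
  have Gphi' : G phi by apply: subG Gphi _; right; exact: subformula_refl.
  rewrite -(filtration_truth subG filtr0 _ Gphi') (yy' phi).
  rewrite (filtration_truth subG filtr0 _ Gphi').
  apply: (filtr_max filtr0 x'y' Gphi).
  rewrite -(filtration_truth subG filtr0 _ Gphi) -(xx' (Box e phi)).
  by rewrite (filtration_truth subG filtr0 _ Gphi).
Qed.

End FilteredFrames.

(** * The filtration of a sharp expansion *)

Section Reduct.
Variables (S T : Type) (f : S -> T).

Definition reduct_frame (F : frame T) : frame S :=
  Frame (world_inhabited F) (fun e => @acc T F (f e)).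

Lemma sat_rename (F : frame T) (V : nat -> world F -> Prop) (x : world F) phi :
  sat (M := Model V) x (rename f phi) <->
  sat (M := @Model S (reduct_frame F) V) x phi.
Proof.
elim: phi x => //= [a IHa b IHb|e a IHa] x; first by rewrite IHa IHb.
by split=> xa y /xa /IHa.
Qed.

Lemma frame_valid_rename (F : frame T) phi :
  frame_valid F (rename f phi) <-> frame_valid (reduct_frame F) phi.
Proof. by split=> Fphi V x; [rewrite -sat_rename|rewrite sat_rename]; apply: Fphi. Qed.

End Reduct.

Lemma frame_of_sharp S (L : set (fm S)) (F : frame (sharp S)) :
  frame_of (sharp_logic L) F <->
  frame_of L (reduct_frame (@Base S) F) /\ @sharp_axioms S `<=` frame_valid F.
Proof.
rewrite frame_of_least_logic subUset; split=> -[FL FA]; split=> //.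
  by move=> a La; rewrite -frame_valid_rename; apply: FL; exists a.
by move=> _ [a La <-]; rewrite frame_valid_rename; exact: FL.
Qed.

Section SharpFrame.
Variables (S W : Type) (W0 : inhabited W) (R : S -> W -> W -> Prop).

Definition sharp_acc (e : sharp S) : W -> W -> Prop :=
  match e with
  | Base a => R a
  | Seqc a b => fun x y => exists2 z, R a x z & R b z y
  | Union a b => fun x y => R a x y \/ R b x y
  | Plus a => clos_trans W (R a)
  end.

Lemma sharp_frame_axioms : @sharp_axioms S `<=` frame_valid (Frame W0 sharp_acc).
Proof.
move=> phi [e [c [->|->|[->|->|->]]]] V x.
- rewrite sat_Iff sat_And /=; split=> [xp|[xe xc] y [/xe|/xc] //].
  by split=> y xy; apply: xp; [left|right].
- rewrite sat_Iff /=; split=> [xp y xy z yz|xp z [y xy yz]].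
    by apply: xp; exists y.
  exact: xp xy _ yz.
- by move=> /= xp y xy; apply: xp; exact: t_step.
- move=> /= xp y xy z yz; apply: xp; apply: t_trans yz; exact: t_step.
- move=> /= step xp y xy.
  have := clos_trans_tn1 _ _ _ _ xy.
  elim=> [z /xp //|z t zt xz pz]; apply: step zt => //.
  exact: clos_tn1_trans.
Qed.

End SharpFrame.

Section SharpStep.
Variables (S : finType) (L : set (fm S)).
Hypotheses (L_logic : is_logic L) (L_filtr : admits_definable_filtration (Mod L)).

Section OneModel.
Variables (G : set (fm (sharp S))) (M : model (sharp S)).
Hypotheses (G_sub : sub_closed G) (ML : Mod (sharp_logic L) M).
Variable l : seq (fm (sharp S)).
Hypothesis G_list : forall phi, List.In phi l <-> G phi.

(** Formulas whose truth sets have to be respected on top of those of [G], so that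
    the modality of a composition or of an iteration can be unfolded by one
    step. *)
Definition unfolded : seq (fm (sharp S)) :=
  l ++ [seq Box (Base ec.1) ec.2 | ec <- List.list_prod (enum S) l].

Lemma unfolded_sub phi : G phi -> List.In phi unfolded.
Proof. by move/G_list => lphi; apply/List.in_or_app; left. Qed.

Lemma unfolded_box e phi : G phi -> List.In (Box (Base e) phi) unfolded.
Proof.
move/G_list => lphi; apply/List.in_or_app; right.
apply/List.in_map_iff; exists (e, phi); split=> //.
by apply/List.in_prod => //; exact: In_enum.
Qed.

(** The basic relations of [M], with fresh variables that name the truth sets of
    the unfolded formulas. *)
Definition named_model : model S :=
  @Model S (reduct_frame (@Base S) M) (fun i (x : world M) =>
    sat x (nth Bot unfolded i)).

Lemma named_sat (x : world M) phi :
  sat (M := named_model) x phi <->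
  sat x (subst (nth Bot unfolded) (rename (@Base S) phi)).
Proof. by rewrite sat_subst sat_rename. Qed.

Lemma named_Mod : Mod L named_model.
Proof.
move=> phi Lphi x; rewrite named_sat.
have HS := least_logic_logic ([set rename (@Base S)
  phi | phi in L] `|` @sharp_axioms S).
apply: ML; apply: (logic_subst HS); apply: least_logic_sub.
by left; exists phi.
Qed.

Definition names : set (fm S) :=
  [set phi | exists2 i, i < size unfolded &
     phi = Var i \/ exists e, phi = Box e (Var i)].

Lemma names_finite : finite_set names.
Proof.
apply: (@list_finite_set _ ([seq Var i | i <- iota 0 (size unfolded)] ++
  [seq Box ei.1 (Var ei.2) | ei <- List.list_prod (enum S) (iota 0 (size unfolded))])).
move=> phi [i iu phiE]; apply/List.in_or_app.
have i_in : List.In i (iota 0 (size unfolded)).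
  by apply/mem_In; rewrite mem_iota.
case: phiE => [->|[e ->]]; [left|right]; apply/List.in_map_iff.
  by exists i.
by exists (e, i); split=> //; apply/List.in_prod => //; exact: In_enum.
Qed.

Lemma names_sub_closed : sub_closed names.
Proof.
move=> phi psi [i iu [->|[e ->]]] /=.
  by move=> [->|//]; exists i => //; left.
move=> [->|[->|//]]; exists i => //; first by right; exists e.
by left.
Qed.

Variables (r : world M -> world M -> Prop) (R : S -> quot r -> quot r -> Prop).
Variable V : nat -> quot r -> Prop.
Hypotheses (filtr : is_filtration (M := named_model) names R V)
  (r_def : definable (M := named_model) r).

Let r_equiv : Equivalence r := filtr_equiv filtr.

Definition sharp_val i (C : quot r) : Prop :=
  exists2 x : world M, C = cls r x & Defs.val i x.

Lemma sharp_definable : definable (M := M) r.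
Proof.
have [P [finP rP]] := r_def.
exists [set subst (nth Bot unfolded) (rename (@Base S) phi) | phi in P].
split; first exact: finite_image.
move=> x y; rewrite rP; split=> [xy _ [phi Pphi <-]|xy phi Pphi].
  by rewrite -!named_sat; exact: xy.
by rewrite !named_sat; apply: xy; exists phi.
Qed.

Lemma unfolded_refines x y phi : r x y -> List.In phi unfolded ->
  sat (M := M) x phi <-> sat (M := M) y phi.
Proof.
move=> rxy /fm_index[i iu <-].
by apply: (filtr_refines filtr rxy (phi := Var i)); exists i => //; left.
Qed.

Lemma base_max e phi (x y : world M) : List.In phi unfolded ->
  R e (cls r x) (cls r y) -> sat x (Box (Base e) phi) -> sat y phi.
Proof.
move=> /fm_index[i iu <-] xy xphi.
apply: (filtr_max filtr xy (phi := Var i)); last exact: xphi.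
by exists i => //; right; exists e.
Qed.

Lemma base_min e (x y : world M) : acc (Base e) x y -> R e (cls r x) (cls r y).
Proof.
move=> xy; apply: (filtr_min filtr); exists x, y.
by split=> //; exact: Equivalence_Reflexive.
Qed.

Lemma axiom_sat phi (x : world M) s :
  @sharp_axioms S phi -> sat x (subst s phi).
Proof.
move=> Aphi; have HS := least_logic_logic ([set rename (@Base S)
  phi | phi in L] `|` @sharp_axioms S).
by apply: ML; apply: (logic_subst HS); apply: least_logic_sub; right.
Qed.

(** The compound relations of [M] need not be the compositions, unions and
    closures of the basic ones, since [M] only satisfies the axioms. They are
    still projected into those of the quotient: a set of classes is definable
    in [M], and the axioms apply to the formula defining it. *)
Lemma sharp_min e (x y : world M) : acc e x y -> sharp_acc R e (cls r x) (cls r y).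
Proof.
have define (B : quot r -> Prop) : exists psi, forall z : world M,
    sat z psi <-> B (cls r z).
  apply: (definable_saturated sharp_definable) => u v.
  by move/(eq_cls r_equiv) => ->.
case: e => [e|e c|e c|e]; first exact: base_min.
- have [psi psiP] := define (fun C => exists2 D, R e (cls r x) D & R c D C).
  move=> xy; apply/psiP.
  have /sat_Iff[_] : sat x (subst (fun=> psi)
      (Iff (Box (Seqc e c) (Var 0)) (Box (Base e) (Box (Base c) (Var 0))))).
    by apply: axiom_sat; exists e, c; constructor 2.
  move=> /=; apply=> // z xz t zt; apply/psiP.
  by exists (cls r z); exact: base_min.
- have [psi psiP] := define (fun C => R e (cls r x) C \/ R c (cls r x) C).
  move=> xy; apply/psiP.
  have /sat_Iff[_] : sat x (subst (fun=> psi)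
      (Iff (Box (Union e c) (Var 0)) (And (Box (Base e) (Var 0)) (Box (Base c)
        (Var 0))))).
    by apply: axiom_sat; exists e, c; constructor 1.
  move=> h; apply: (h _ y xy).
  by apply/sat_And; split=> z xz; apply/psiP; [left|right]; exact: base_min.
- have [psi psiP] := define (clos_trans _ (R e) (cls r x)).
  move=> xy; apply/psiP.
  have := @axiom_sat (Imp (Box (Plus e) (Imp (Var 0) (Box (Base e) (Var 0))))
    (Imp (Box (Base e) (Var 0)) (Box (Plus e) (Var 0)))) x (fun=> psi).
  move=> /=; apply=> //.
  + by exists e, e; constructor 3; constructor 3.
  + move=> z _ /psiP xz t zt; apply/psiP; apply: t_trans xz _.
    by apply: t_step; exact: base_min.
  + by move=> z xz; apply/psiP; apply: t_step; exact: base_min.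
Qed.

(** Along a path of basic steps the axioms carry [Box (Plus e) phi] from each point to
    the next, together with [phi]. *)
Lemma sharp_max e phi (x y : world M) : G (Box e phi) ->
  sharp_acc R e (cls r x) (cls r y) -> sat x (Box e phi) -> sat y phi.
Proof.
move=> Gb; have Gphi : G phi by apply: G_sub Gb _; right; exact: subformula_refl.
have phi_u := unfolded_sub Gphi; have box_u := unfolded_box _ Gphi.
case: e Gb => [e|e c|e c|e] Gb /= xy xphi.
- exact: base_max xy xphi.
- have [C + Cy] := xy; have [z Cz] := cls_surj C; rewrite {C}Cz in Cy * => xz.
  apply: base_max Cy _ => //; apply: base_max xz _; first exact: box_u.
  have /sat_Iff[+ _] : sat x (subst (fun=> phi)
      (Iff (Box (Seqc e c) (Var 0)) (Box (Base e) (Box (Base c) (Var 0))))).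
    by apply: axiom_sat; exists e, c; constructor 2.
  exact.
- have /sat_Iff[+ _] : sat x (subst (fun=> phi)
      (Iff (Box (Union e c) (Var 0)) (And (Box (Base e) (Var 0)) (Box (Base c)
        (Var 0))))).
    by apply: axiom_sat; exists e, c; constructor 1.
  move=> /(_ xphi) /sat_And[xe xc].
  by case: xy => xy; [exact: base_max xy xe|exact: base_max xy xc].
- have step (z t : world M) : R e (cls r z) (cls r t) ->
      sat z (Box (Plus e) phi) -> sat t (Box (Plus e) phi) /\ sat t phi.
    move=> zt zphi; split.
      apply: base_max zt _; first exact: unfolded_sub.
      have := @axiom_sat (Imp (Box (Plus e) (Var 0)) (Box (Base e) (Box (Plus e)
        (Var 0)))) z (fun=> phi).
      by apply=> //; exists e, e; constructor 3; constructor 2.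
    apply: base_max zt _ => //.
    have := @axiom_sat (Imp (Box (Plus e) (Var 0)) (Box (Base e) (Var 0)))
      z (fun=> phi).
    by apply=> //; exists e, e; constructor 3; constructor 1.
  suff reach C D : clos_trans _ (R e) C D -> forall z t, C = cls r z -> D = cls r t ->
      sat z (Box (Plus e) phi) -> sat t (Box (Plus e) phi) /\ sat t phi.
    by have [] := reach _ _ xy _ _ erefl erefl xphi.
  elim=> {C D} [C D CD z t Cz Dt|C D E _ IH1 _ IH2 z t Cz Et zphi].
    by apply: step; rewrite -Cz -Dt.
  have [u Du] := cls_surj D; have [uphi _] := IH1 z u Cz Du zphi.
  exact: IH2 Du Et uphi.
Qed.

Lemma sharp_filtration : is_filtration (M := M) G (sharp_acc R) sharp_val.
Proof.
have refines (x y : world M) : r x y -> fm_equiv G x y.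
  by move=> xy phi Gphi; apply: unfolded_refines xy _; exact: unfolded_sub.
split=> //; first exact: filtr_finite filtr.
- move=> p x Gp; split=> [[y /(eq_cls r_equiv) xy yp]|xp]; last by exists x.
  exact/(refines _ _ xy _ Gp).
- move=> e x y [x' [y' [/(eq_cls r_equiv) -> /(eq_cls r_equiv) -> x'y']]].
  exact: sharp_min.
- by move=> e x y xy phi Gb; exact: sharp_max.
Qed.

End OneModel.

(** Given the filtration of the reduct, whose frame is a frame of [L], the
    compound relations of the quotient are interpreted in the standard way. *)
Theorem sharp_admits_filtration : admits_definable_filtration (Mod (sharp_logic L)).
Proof.
move=> G Gfin Gsub M ML; have [l lP] := finite_set_list Gfin.
have [r [R [V [filtr def_r FL]]]] := filtration_frame_of L_logic L_filtr
  (names_finite l) (@names_sub_closed l) (named_Mod (l := l) ML).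
exists r, (sharp_acc R), (sharp_val (r := r)); split.
- exact: (sharp_filtration Gsub ML lP filtr def_r).
- exact: sharp_definable def_r.
- have FS : frame_of (sharp_logic L)
      (Frame (quot_inhabited r (world_inhabited M)) (sharp_acc R)).
    by apply/frame_of_sharp; split; [exact: FL|exact: sharp_frame_axioms].
  by move=> phi Lphi; exact: FS.
Qed.

End SharpStep.

(** * The finite model property *)

Lemma subformula_trans S (a b c : fm S) :
  subformula a b -> subformula b c -> subformula a c.
Proof.
move=> ab; elim: c => [|i|c IHc d IHd|e c IHc] /=.
- by move=> [bE|//]; rewrite bE in ab.
- by move=> [bE|//]; rewrite bE in ab.
- by move=> [bE|[/IHc|/IHd]]; [rewrite bE in ab|right; left|right; right].
- by move=> [bE|/IHc]; [rewrite bE in ab|right].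
Qed.

Lemma subformulas_finite S (phi : fm S) : finite_set [set psi | subformula psi phi].
Proof.
have sing (x : fm S) : finite_set [set x] by exact: finite_set1.
elim: phi => [|i|a fa b fb|e a fa] /=.
- by apply: sub_finite_set (sing Bot) => x [->|].
- by apply: sub_finite_set (sing (Var i)) => x [->|].
- apply: (@sub_finite_set _ _ ([set Imp a b] `|` ([set psi | subformula psi a] `|`
    [set psi | subformula psi b]))) => //.
  by rewrite !finite_setU.
- apply: (@sub_finite_set _ _ ([set Box e a] `|` [set psi | subformula psi a])) => //.
  by rewrite !finite_setU.
Qed.

Section FiniteModelProperty.
Variables (S : Type) (L : set (fm S)).
Hypotheses (L_logic : is_logic L) (L_filtr : admits_definable_filtration (Mod L)).

(** The canonical model is filtrated through the subformulas of [phi]. *)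
Lemma finite_countermodel phi : ~ L phi ->
  exists F : frame S, [/\ finite_frame F, frame_of L F & ~ frame_valid F phi].
Proof.
move=> /(logic_countermodel L_logic)[M [ML [x nphi]]].
have subG : sub_closed [set psi | subformula psi phi].
  by move=> a b /= aphi ba; exact: subformula_trans aphi.
have [r [R [V [filtr _ FL]]]] := filtration_frame_of L_logic L_filtr
  (subformulas_finite phi) subG ML.
exists (quot_model R V); split=> //; first exact: filtr_finite filtr.
move=> /(_ V (cls r x)) /(filtration_truth subG filtr) xphi; apply: nphi.
exact/xphi/subformula_refl.
Qed.

Lemma logic_of_finite_frames :
  L = logic_of_frames (fun F => finite_frame F /\ frame_of L F).
Proof.
apply/seteqP; split=> phi /=; first by move=> Lphi F [_]; exact.
move=> valid; apply: contrapT => /finite_countermodel[F [finF LF]]; apply.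
exact: valid.
Qed.

End FiniteModelProperty.

Lemma logic_iter_logic (S : finType) (L : set (fm S)) n :
  is_logic L -> is_logic (logic_iter L n).
Proof. by case: n => //= n _; exact: least_logic_logic. Qed.

Lemma logic_iter_filtration (S : finType) (L : set (fm S)) n : is_logic L ->
  admits_definable_filtration (Mod L) ->
  admits_definable_filtration (Mod (logic_iter L n)).
Proof.
move=> HL fL; elim: n => //= n IH.
by apply: sharp_admits_filtration => //; exact: logic_iter_logic.
Qed.

(** * Computable functions on natural numbers *)

Lemma computes_fun n (c : recf n) xs y y' :
  computes c xs y -> computes c xs y' -> y = y'.
Proof.
elim: c xs y y' => {n} [n|||n m f IHf g IHg|n f IHf g IHg|n f IHf] xs y y'.
- by move=> -> ->.
- by move=> -> ->.
- by move=> n i /= -> ->.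
- move=> /= [zs [szs gzs fzs]] [zs' [szs' gzs' fzs']].
  suff zsE : zs = zs' by rewrite -zsE in fzs'; exact: IHf fzs fzs'.
  apply: (@eq_from_nth _ 0); first by rewrite szs.
  move=> i; rewrite szs => im.
  exact: IHg (gzs (Ordinal im)) (gzs' (Ordinal im)).
- move=> /=; elim: (head 0 xs) y y' => [|k IHk] y y'; first exact: IHf.
  by move=> [u ku gu] [u' /(IHk _ _ ku) <-]; exact: IHg.
- move=> /= [fy ly] [fy' ly']; apply/eqP; rewrite eqn_leq.
  apply/andP; split; rewrite leqNgt; apply/negP.
    by move=> /ly[v /(IHf _ _ _ fy')].
  by move=> /ly'[v /(IHf _ _ _ fy)].
Qed.

Definition rcomp n (f : seq nat -> nat) : Prop :=
  exists c : recf n, forall xs, size xs = n -> computes c xs (f xs).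

Lemma eq_rcomp n f f' : (forall xs, size xs = n -> f xs = f' xs) ->
  rcomp n f -> rcomp n f'.
Proof. by move=> ff' [c cf]; exists c => xs sxs; rewrite -ff' //; exact: cf. Qed.

Lemma rcomp_zero n : rcomp n (fun=> 0).
Proof. by exists (Zero n). Qed.

Lemma rcomp_nth n i : i < n -> rcomp n (fun xs => nth 0 xs i).
Proof. by move=> lt_in; exists (Proj (Ordinal lt_in)). Qed.

Lemma rcomp_comp n m f (g : nat -> seq nat -> nat) : rcomp m f ->
  (forall i, i < m -> rcomp n (g i)) -> rcomp n (fun xs => f (mkseq (g^~ xs) m)).
Proof.
move=> [cf cfP] gP.
have [cg cgP] := choice (fun i : 'I_m => gP i (ltn_ord i)).
exists (Compose cf cg) => xs sxs /=; exists (mkseq (g^~ xs) m).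
split; first by rewrite size_mkseq.
- by move=> i; rewrite nth_mkseq //; exact: cgP.
- by apply: cfP; rewrite size_mkseq.
Qed.

Definition comp1 (f : nat -> nat) := rcomp 1 (fun xs => f (nth 0 xs 0)).
Definition comp2 (f : nat -> nat -> nat) :=
  rcomp 2 (fun xs => f (nth 0 xs 0) (nth 0 xs 1)).
Definition comp3 (f : nat -> nat -> nat -> nat) :=
  rcomp 3 (fun xs => f (nth 0 xs 0) (nth 0 xs 1) (nth 0 xs 2)).

Lemma rcomp_app1 n f g : comp1 f -> rcomp n g -> rcomp n (fun xs => f (g xs)).
Proof. by move=> cf cg; apply: (@rcomp_comp n 1 _ (fun=> g) cf). Qed.

Lemma rcomp_app2 n f g h : comp2 f -> rcomp n g -> rcomp n h ->
  rcomp n (fun xs => f (g xs) (h xs)).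
Proof.
move=> cf cg ch.
by apply: (@rcomp_comp n 2 _ (fun i => if i is 0 then g else h) cf) => -[|].
Qed.

Definition prim_rec (T : Type) (z : T) (s : nat -> T -> T) : nat -> T :=
  fix loop k := if k is k'.+1 then s k' (loop k') else z.

Lemma comp2_rec f g : comp1 f -> comp3 g ->
  comp2 (fun k x => prim_rec (f x) (fun k' v => g k' v x) k).
Proof.
move=> [cf cfP] [cg cgP]; exists (PrimRec cf cg) => -[|k [|x []]] //= _.
elim: k => [|k IHk]; first exact: (cfP [:: x]).
by eexists; first exact: IHk; exact: (cgP [:: _; _; _]).
Qed.

Lemma comp1_diag f : comp2 f -> comp1 (fun x => f x x).
Proof. by move=> cf; apply: (rcomp_app2 cf); apply: rcomp_nth. Qed.

Lemma comp1_succ : comp1 succn.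
Proof. by exists Succ => -[|x []]. Qed.

Lemma comp2_add : comp2 addn.
Proof.
apply: (eq_rcomp _ (comp2_rec (f := id) (g := fun _ v _ => v.+1) _ _)).
- by move=> [|k [|x []]] //= _; elim: k => //= k ->.
- exact: rcomp_nth.
- by apply: rcomp_app1 comp1_succ _; apply: rcomp_nth.
Qed.

Lemma comp1_pred : comp1 predn.
Proof.
apply: (@eq_rcomp _ _ _ _ (comp1_diag (comp2_rec (f := fun=> 0) (g := fun k _ _ =>
  k) _ _))).
- by move=> [|[|k] []].
- exact: rcomp_zero.
- exact: rcomp_nth.
Qed.

Lemma comp2_sub : comp2 (fun k x => x - k).
Proof.
apply: (eq_rcomp _ (comp2_rec (f := id) (g := fun _ v _ => v.-1) _ _)).
- by move=> [|k [|x []]] //= _; elim: k => [|k /= ->]; rewrite ?subn0 ?subnS.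
- exact: rcomp_nth.
- by apply: rcomp_app1 comp1_pred _; apply: rcomp_nth.
Qed.

Lemma rcomp_const n k : rcomp n (fun=> k).
Proof. by elim: k => [|k IH]; [exact: rcomp_zero|exact: rcomp_app1 comp1_succ IH]. Qed.

Definition triangle n := 'C(n.+1, 2).

Lemma triangleS n : triangle n.+1 = triangle n + n.+1.
Proof. by rewrite /triangle binS bin1. Qed.

Lemma comp1_triangle : comp1 triangle.
Proof.
apply: (@eq_rcomp _ _ _ _ (comp1_diag (comp2_rec (f := fun=> 0) (g := fun k v _ =>
  v + k.+1) _ _))).
- move=> [|n []] //= _; suff rE k : prim_rec 0 (fun k' v =>
  v + k'.+1) k = triangle k by [].
  by elim: k => //= k ->; rewrite triangleS.
- exact: rcomp_zero.
- apply: rcomp_app2 comp2_add _ _; first exact: rcomp_nth.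
  by apply: rcomp_app1 comp1_succ _; apply: rcomp_nth.
Qed.

Lemma comp2_pair : comp2 code_pair.
Proof.
apply: rcomp_app2 comp2_add _ _; last exact: rcomp_nth.
by apply: rcomp_app1 comp1_triangle _; exact: comp2_add.
Qed.

(** The index of the diagonal of the Cantor pairing that contains [k]: it moves on
    when the next triangular number is reached. *)
Definition diagonal : nat -> nat :=
  prim_rec 0 (fun k w => w + (1 - (triangle w.+1 - k.+1))).

Lemma diagonalP k : triangle (diagonal k) <= k < triangle (diagonal k).+1.
Proof.
elim: k => [|k /andP[IH1 IH2]]; first by [].
change (diagonal k.+1) with
  (diagonal k + (1 - (triangle (diagonal k).+1 - k.+1))).
set w := diagonal k in IH1 IH2 *.
case: (ltngtP (triangle w.+1) k.+1) => [|lt|eq_tri]; first by rewrite ltnNge IH2.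
- have -> : 1 - (triangle w.+1 - k.+1) = 0 by apply/eqP; rewrite subn_eq0 subn_gt0.
  by rewrite addn0 (leq_trans IH1) //= lt.
- by rewrite eq_tri subnn addn1 eq_tri leqnn /= triangleS eq_tri addnS ltnS leq_addr.
Qed.

Lemma triangle_mono : {homo triangle : m n / m <= n}.
Proof. by apply: homo_leq leqnn leq_trans _ => n; rewrite triangleS leq_addr. Qed.

Lemma diagonal_pair x y : diagonal (code_pair x y) = x + y.
Proof.
have /andP[lo hi] := diagonalP (code_pair x y).
set w := diagonal _ in lo hi *; apply/eqP; rewrite eqn_leq.
apply/andP; split; rewrite leqNgt; apply/negP => /triangle_mono le_tri.
  have := leq_trans le_tri lo.
  by rewrite triangleS /code_pair -/(triangle _) leq_add2l ltnNge leq_addl.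
have := leq_trans hi le_tri.
by rewrite /code_pair -/(triangle _) ltnNge leq_addr.
Qed.

Lemma leq_code_pairl x y : x <= code_pair x y.
Proof.
have le_tri n : n <= triangle n by case: n => // n; rewrite triangleS leq_addl.
apply: leq_trans (leq_addr y x) _; apply: leq_trans (le_tri _) _.
exact: leq_addr.
Qed.

Lemma leq_code_pairr x y : y <= code_pair x y.
Proof. exact: leq_addl. Qed.

Definition snd_code k := k - triangle (diagonal k).
Definition fst_code k := diagonal k - snd_code k.

Lemma snd_codeK x y : snd_code (code_pair x y) = y.
Proof. by rewrite /snd_code diagonal_pair /code_pair addKn. Qed.

Lemma fst_codeK x y : fst_code (code_pair x y) = x.
Proof. by rewrite /fst_code diagonal_pair snd_codeK addnK. Qed.

Lemma code_pairK k : code_pair (fst_code k) (snd_code k) = k.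
Proof.
have /andP[lo hi] := diagonalP k.
have le_sd : snd_code k <= diagonal k.
  by rewrite /snd_code leq_subLR -ltnS -addnS -triangleS.
by rewrite /code_pair -/(triangle _) /fst_code subnK // /snd_code subnKC.
Qed.

Lemma comp1_diagonal : comp1 diagonal.
Proof.
apply: (@eq_rcomp _ _ _ _ (comp1_diag (comp2_rec (f := fun=> 0)
  (g := fun k w _ => w + (1 - (triangle w.+1 - k.+1))) _ _))) => //.
- exact: rcomp_zero.
- apply: rcomp_app2 comp2_add _ _; first exact: rcomp_nth.
  apply: (rcomp_app2 comp2_sub (g := fun xs =>
    triangle (nth 0 xs 1).+1 - (nth 0 xs 0).+1)).
    apply: (rcomp_app2 comp2_sub (g := fun xs => (nth 0 xs 0).+1)).
      by apply: rcomp_app1 comp1_succ _; apply: rcomp_nth.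
    apply: rcomp_app1 comp1_triangle _.
    by apply: rcomp_app1 comp1_succ _; apply: rcomp_nth.
  exact: rcomp_const.
Qed.

Lemma comp1_snd : comp1 snd_code.
Proof.
apply: (rcomp_app2 comp2_sub (g := fun xs => triangle (diagonal (nth 0 xs 0)))).
  by apply: rcomp_app1 comp1_triangle _; exact: comp1_diagonal.
exact: rcomp_nth.
Qed.

Lemma comp1_fst : comp1 fst_code.
Proof.
by apply: (rcomp_app2 comp2_sub (g := fun xs => snd_code (nth 0 xs 0)));
  [exact: comp1_snd|exact: comp1_diagonal].
Qed.

Lemma comp1_comp f g : comp1 f -> comp1 g -> comp1 (fun n => f (g n)).
Proof. by move=> cf cg; apply: rcomp_app1 cf _. Qed.

Lemma comp1_pair f g : comp1 f -> comp1 g -> comp1 (fun n => code_pair (f n) (g n)).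
Proof. by move=> cf cg; apply: rcomp_app2 comp2_pair _ _. Qed.

Lemma comp1_rec f g h : comp1 f -> comp1 g -> comp1 h ->
  comp1 (fun x => prim_rec (f x) (fun k v => g (code_pair x (code_pair k v))) (h x)).
Proof.
move=> cf cg ch.
apply: (rcomp_app2 (comp2_rec (f := f) (g := fun k v x =>
  g (code_pair x (code_pair k v))) _ _) ch).
- exact: cf.
- apply: rcomp_app1 cg _; apply: rcomp_app2 comp2_pair _ _; first exact: rcomp_nth.
  by apply: rcomp_app2 comp2_pair _ _; apply: rcomp_nth.
- exact: rcomp_nth.
Qed.

Lemma comp1_if b f g : comp1 b -> comp1 f -> comp1 g ->
  comp1 (fun x => if b x is 0 then g x else f x).
Proof.
move=> cb cf cg.
have cf' : comp1 (fun u => f (fst_code u)) := comp1_comp cf comp1_fst.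
apply: (@eq_rcomp _ _ _ _ (comp1_rec cg cf' cb)) => -[|x []] //= _.
by case: (b x) => //= k; rewrite fst_codeK.
Qed.

(** * Computable functions on coded types *)

Class coded (A : Type) := code : A -> nat.

#[export] Instance coded_nat : coded nat := id.
#[export] Instance coded_bool : coded bool := nat_of_bool.
#[export] Instance coded_pair A B (cA : coded A) (cB : coded B) : coded (A * B) :=
  fun u => code_pair (code u.1) (code u.2).
#[export] Instance coded_seq A (cA : coded A) : coded (seq A) :=
  fun s => code_seq (map code s).

(** A computable function acts on codes through a total computable function on
    natural numbers, whose values off the codes do not matter. *)
Definition computable A B (cA : coded A) (cB : coded B) (f : A -> B) : Prop :=
  exists2 r, comp1 r & forall a, r (code a) = code (f a).
Arguments computable {A B cA cB} f.

Lemma computable_comp X A B (cX : coded X) (cA : coded A) (cB : coded B)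
    (g : A -> B) (f : X -> A) : computable g -> computable f -> computable (fun x =>
      g (f x)).
Proof.
move=> [rg cg gE] [rf cf fE]; exists (fun n => rg (rf n)); first exact: comp1_comp.
by move=> x; rewrite fE gE.
Qed.

Lemma computable_recode A B (cA : coded A) (cB : coded B) (f : A -> B) :
  (forall a, code (f a) = code a) -> computable f.
Proof. by move=> fE; exists id => //; exact: rcomp_nth. Qed.

Section Basics.
Context {X A B C : Type} {cX : coded X} {cA : coded A} {cB : coded B} {cC : coded C}.

Lemma eq_computable (f g : A -> B) : f =1 g -> computable f -> computable g.
Proof. by move=> fg [r cr rf]; exists r => // a; rewrite rf fg. Qed.

Lemma computable_id : computable (fun x : X => x).
Proof. by exists id => //; exact: rcomp_nth. Qed.

Lemma computable_const (a : A) : computable (fun _ : X => a).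
Proof. by exists (fun=> code a) => //; exact: rcomp_const. Qed.

Lemma computable_code (f : X -> A) : computable f -> computable (fun x => code (f x)).
Proof. by move=> cf; apply: (computable_comp (g := @code A cA)) cf;
  exact: computable_recode. Qed.

Lemma computable_pair (f : X -> A) (g : X -> B) : computable f -> computable g ->
  computable (fun x => (f x, g x)).
Proof.
move=> [rf cf fE] [rg cg gE]; exists (fun n => code_pair (rf n) (rg n)).
  exact: comp1_pair.
by move=> x; rewrite fE gE.
Qed.

Lemma computable_fst (f : X -> A * B) : computable f -> computable (fun x => (f x).1).
Proof.
apply: (computable_comp (g := fun u : A * B => u.1)).
by exists fst_code; [exact: comp1_fst|move=> a; exact: fst_codeK].
Qed.

Lemma computable_snd (f : X -> A * B) : computable f -> computable (fun x => (f x).2).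
Proof.
apply: (computable_comp (g := fun u : A * B => u.2)).
by exists snd_code; [exact: comp1_snd|move=> a; exact: snd_codeK].
Qed.

Lemma computable_succ (f : X -> nat) : computable f -> computable (fun x => (f x).+1).
Proof.
by apply: (computable_comp (g := succn)); exists succn => //; exact: comp1_succ.
Qed.

Lemma computable_pred (f : X -> nat) : computable f -> computable (fun x => (f x).-1).
Proof.
by apply: (computable_comp (g := predn)); exists predn => //; exact: comp1_pred.
Qed.

Lemma computable_prim_rec (z : X -> A) (s : X -> nat -> A -> A) (n : X -> nat) :
  computable z -> computable (fun u : X * (nat * A) =>
    s u.1 u.2.1 u.2.2) -> computable n ->
  computable (fun x => prim_rec (z x) (s x) (n x)).
Proof.
move=> [rz cz zE] [rs cs sE] [rn cn nE].
exists (fun x => prim_rec (rz x) (fun k v => rs (code_pair x (code_pair k v))) (rn x)).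
  exact: comp1_rec.
move=> x; rewrite zE nE; rewrite [X in prim_rec _ _ X]/(code _) /=.
by elim: (n x) => //= k ->; exact: (sE (x, (k, prim_rec (z x) (s x) k))).
Qed.

Lemma computable_if (b : X -> bool) (f g : X -> A)
  : computable b -> computable f -> computable g ->
  computable (fun x => if b x then f x else g x).
Proof.
move=> [rb cb bE] [rf cf fE] [rg cg gE].
exists (fun x => if rb x is 0 then rg x else rf x); first exact: comp1_if.
by move=> x; rewrite bE fE gE; case: (b x).
Qed.

Lemma computable_eq0 (f : X -> nat) : computable f -> computable (fun x => f x == 0).
Proof.
move=> [r cr rE]; exists (fun x => if r x is 0 then 1 else 0).
  by apply: comp1_if => //; exact: rcomp_const.
by move=> x; rewrite rE; case: (f x).
Qed.

End Basics.

(* The search is directed by the head symbol of the function. A function of one, two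
   or three arguments that a hypothesis, stated on tuples, makes computable may be
   applied to any computable arguments. *)
Create HintDb computable.

#[export] Hint Extern 0 (computable _) =>
  first [assumption | simple apply computable_const | simple apply computable_id]
    : computable.
#[export] Hint Extern 1 (computable (fun x => fst _)) =>
  simple eapply computable_fst : computable.
#[export] Hint Extern 1 (computable (fun x => snd _)) =>
  simple eapply computable_snd : computable.
#[export] Hint Extern 1 (computable (fun x => pair _ _)) =>
  simple apply computable_pair : computable.
#[export] Hint Extern 1 (computable (fun x => S _)) =>
  simple apply computable_succ : computable.
#[export] Hint Extern 1 (computable (fun x => predn _)) =>
  simple apply computable_pred : computable.
#[export] Hint Extern 1 (computable (fun x => code _)) =>
  simple apply computable_code : computable.
#[export] Hint Extern 1 (computable (fun x => prim_rec _ _ _)) =>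
  simple apply computable_prim_rec : computable.
#[export] Hint Extern 1 (computable (fun x => match _ with true => _ | false =>
  _ end)) =>
  simple apply computable_if : computable.
#[export] Hint Extern 2 (@computable ?A ?B ?a ?b ?f) =>
  lazymatch f with
  | (fun x => _) => fail
  | _ => change (@computable A B a b (fun x => f x))
  end : computable.
#[export] Hint Extern 2 (computable _) =>
  match goal with
  | H : computable ?g |- computable (fun x => ?g (@?h x)) =>
      apply (computable_comp (f := h) H)
  | H : computable (fun u => ?g (fst u) (snd u)) |- computable (fun x =>
    ?g (@?h x) (@?k x)) =>
      apply (computable_comp (f := fun x => (h x, k x)) H)
  | H : computable (fun u => ?g (fst u) (fst (snd u)) (snd (snd u)))
    |- computable (fun x => ?g (@?h x) (@?k x) (@?l x)) =>
      apply (computable_comp (f := fun x => (h x, (k x, l x))) H)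
  end; cbv beta : computable.

Ltac computable_auto := solve [eauto 1000 with computable].

Section Arithmetic.
Context {X : Type} {cX : coded X}.

Lemma computable_addn (f g : X -> nat) : computable f -> computable g -> computable
  (fun x => f x + g x).
Proof.
move=> cf cg; apply: (@eq_computable _ _ _ _ (fun x => prim_rec (g x) (fun _ v =>
  v.+1) (f x))).
  by move=> x; elim: (f x) => //= k ->.
computable_auto.
Qed.

Lemma computable_subn (f g : X -> nat) : computable f -> computable g -> computable
  (fun x => f x - g x).
Proof.
move=> cf cg; apply: (@eq_computable _ _ _ _ (fun x => prim_rec (f x) (fun _ v =>
  v.-1) (g x))).
  by move=> x; elim: (g x) => [|k /= ->]; rewrite ?subn0 ?subnS.
computable_auto.
Qed.

End Arithmetic.

#[export] Hint Extern 1 (computable (fun x => addn _ _)) =>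
  simple apply computable_addn : computable.
#[export] Hint Extern 1 (computable (fun x => subn _ _)) =>
  simple apply computable_subn : computable.

Section Comparisons.
Context {X : Type} {cX : coded X}.

Lemma computable_muln (f g : X -> nat) : computable f -> computable g -> computable
  (fun x => f x * g x).
Proof.
move=> cf cg; apply: (@eq_computable _ _ _ _ (fun x => prim_rec 0 (fun _ v =>
  g x + v) (f x))).
  by move=> x; elim: (f x) => //= k ->.
computable_auto.
Qed.

Lemma computable_leq (f g : X -> nat) : computable f -> computable g -> computable
  (fun x => f x <= g x).
Proof. by move=> cf cg; apply: computable_eq0; exact: computable_subn. Qed.

Lemma computable_negb (f : X -> bool) : computable f -> computable (fun x => ~~ f x).
Proof. move=> cf; apply: computable_if => //; exact: computable_const. Qed.

Lemma computable_andb (f g : X -> bool) : computable f -> computable g -> computable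
  (fun x => f x && g x).
Proof. move=> cf cg; apply: computable_if => //; exact: computable_const. Qed.

Lemma computable_implb (f g : X -> bool) : computable f -> computable g -> computable
  (fun x => f x ==> g x).
Proof. move=> cf cg; apply: computable_if => //; exact: computable_const. Qed.

Lemma computable_eqn (f g : X -> nat) : computable f -> computable g -> computable
  (fun x => f x == g x).
Proof.
move=> cf cg; apply: (@eq_computable _ _ _ _ (fun x => (f x <= g x) && (g x <= f x))).
  by move=> x; rewrite eqn_leq.
by apply: computable_andb; exact: computable_leq.
Qed.

End Comparisons.

#[export] Hint Extern 1 (computable (fun x => muln _ _)) =>
  simple apply computable_muln : computable.
#[export] Hint Extern 1 (computable (fun x => leq _ _)) =>
  simple apply computable_leq : computable.
#[export] Hint Extern 1 (computable (fun x => negb _)) =>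
  simple apply computable_negb : computable.
#[export] Hint Extern 1 (computable (fun x => andb _ _)) =>
  simple apply computable_andb : computable.
#[export] Hint Extern 1 (computable (fun x => implb _ _)) =>
  simple apply computable_implb : computable.
#[export] Hint Extern 1 (computable (fun x => _ == _)) =>
  simple apply computable_eqn : computable.

Section Sequences.
Context {X A B : Type} {cX : coded X} {cA : coded A} {cB : coded B}.

Lemma code_cons (a : A) s : code (a :: s) = (code (a, s)).+1.
Proof. by []. Qed.

Lemma computable_cons (f : X -> A) (l : X -> seq A) : computable f -> computable l ->
  computable (fun x => f x :: l x).
Proof.
move=> cf cl; have [r cr rE] := computable_succ (computable_code (computable_pair cf
  cl)).
by exists r => // x; rewrite rE.
Qed.

Lemma computable_case (z : X -> B) (f : X -> A -> seq A -> B) (l : X -> seq A) :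
  computable z -> computable (fun u : X * (A * seq A) =>
    f u.1 u.2.1 u.2.2) -> computable l ->
  computable (fun x => if l x is a :: s then f x a s else z x).
Proof.
move=> [rz cz zE] [rf cf fE] [rl cl lE]; have [rx cx xE] := @computable_id X _.
exists (fun n => if rl n is 0 then rz n else rf (code_pair (rx n) (rl n).-1)).
  apply: comp1_if => //; apply: (comp1_comp cf); apply: comp1_pair => //.
  exact: comp1_comp comp1_pred cl.
move=> x; rewrite lE zE; case: (l x) => // a s.
by rewrite code_cons /= xE; exact: (fE (x, (a, s))).
Qed.

Lemma size_code_seq (s : seq A) : size s <= code s.
Proof.
elim: s => //= a s IH; rewrite code_cons ltnS (leq_trans IH) //; exact: leq_addl.
Qed.

End Sequences.

#[export] Hint Extern 1 (computable (fun x => cons _ _)) =>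
  simple apply computable_cons : computable.
#[export] Hint Extern 1 (computable (fun x => match _ with nil => _ | cons _ _ =>
  _ end)) => simple apply computable_case : computable.

Section Folds.
Context {X A B : Type} {cX : coded X} {cA : coded A} {cB : coded B}.

(** The code of a sequence bounds its size: iterating that many times the step that
    absorbs one element exhausts it. *)
Lemma computable_foldl (f : X -> B -> A -> B) (z : X -> B) (l : X -> seq A) :
  computable (fun u : X * (B * A) => f u.1 u.2.1 u.2.2)
    -> computable z -> computable l ->
  computable (fun x => foldl (f x) (z x) (l x)).
Proof.
move=> cf cz cl.
apply: (@eq_computable _ _ _ _ (fun x => (prim_rec (l x, z x)
  (fun _ st => if st.1 is a :: s then (s, f x st.2 a) else st) (code (l x))).2)).
  move=> x; set step := fun _ _ => _.
  suff loopE n s b : size s <= n -> (prim_rec (s, b) step n).2 = foldl (f x) b s.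
    exact/loopE/size_code_seq.
  have shift k st : prim_rec st step k.+1 = prim_rec (step 0 st) step k.
    by elim: k => //= k ->.
  elim: n s b => [|n IH] [|a s] b // le_sn; rewrite shift; last exact: IH.
  by rewrite /step /= IH.
computable_auto.
Qed.

End Folds.

#[export] Hint Extern 1 (computable (fun x => foldl _ _ _)) =>
  simple apply computable_foldl : computable.

Section SequenceFunctions.
Context {X A B : Type} {cX : coded X} {cA : coded A} {cB : coded B}.

Lemma computable_rev (l : X -> seq A) : computable l -> computable (fun x => rev (l x)).
Proof.
move=> cl; apply: (@eq_computable _ _ _ _ (fun x => foldl (fun s a =>
  a :: s) [::] (l x))).
  by move=> x; rewrite -[RHS]cats0 -catrevE; elim: (l x) [::] => //= a s IH t;
    rewrite IH.
computable_auto.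
Qed.

End SequenceFunctions.

#[export] Hint Extern 1 (computable (fun x => rev _)) =>
  simple apply computable_rev : computable.

Lemma computable_foldr {X A B} {cX : coded X} {cA : coded A} {cB : coded B}
    (f : X -> A -> B -> B) (z : X -> B) (l : X -> seq A) :
  computable (fun u : X * (A * B) => f u.1 u.2.1 u.2.2)
    -> computable z -> computable l ->
  computable (fun x => foldr (f x) (z x) (l x)).
Proof.
move=> cf cz cl.
apply: (@eq_computable _ _ _ _ (fun x => foldl (fun b a => f x a b) (z x) (rev (l x)))).
  by move=> x; rewrite foldl_rev.
computable_auto.
Qed.

#[export] Hint Extern 1 (computable (fun x => foldr _ _ _)) =>
  simple apply computable_foldr : computable.

Section MoreSequenceFunctions.
Context {X A B : Type} {cX : coded X} {cA : coded A} {cB : coded B}.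

Lemma computable_map (f : X -> A -> B) (l : X -> seq A) :
  computable (fun u : X * A => f u.1 u.2) -> computable l ->
  computable (fun x => [seq f x a | a <- l x]).
Proof.
move=> cf cl.
apply: (@eq_computable _ _ _ _ (fun x => foldr (fun a s => f x a :: s) [::] (l x))).
  by move=> x; elim: (l x) => //= a s ->.
computable_auto.
Qed.

Lemma computable_filter (p : X -> A -> bool) (l : X -> seq A) :
  computable (fun u : X * A => p u.1 u.2) -> computable l ->
  computable (fun x => [seq a <- l x | p x a]).
Proof.
move=> cp cl.
apply: (@eq_computable _ _ _ _ (fun x => foldr (fun a s =>
  if p x a then a :: s else s) [::] (l x))).
  by move=> x; elim: (l x) => //= a s ->.
computable_auto.
Qed.

Lemma computable_all (p : X -> A -> bool) (l : X -> seq A) :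
  computable (fun u : X * A => p u.1 u.2) -> computable l ->
  computable (fun x => all (p x) (l x)).
Proof.
move=> cp cl.
apply: (@eq_computable _ _ _ _ (fun x => foldr (fun a b => p x a && b) true (l x))).
  by move=> x; elim: (l x) => //= a s ->.
computable_auto.
Qed.

Lemma computable_cat (l m : X -> seq A) : computable l -> computable m ->
  computable (fun x => l x ++ m x).
Proof.
move=> cl cm.
apply: (@eq_computable _ _ _ _ (fun x => foldr cons (m x) (l x))).
  by move=> x; elim: (l x) => //= a s ->.
computable_auto.
Qed.

Lemma computable_nth (d : X -> A) (l : X -> seq A) (i : X -> nat) :
  computable d -> computable l -> computable i -> computable (fun x =>
    nth (d x) (l x) (i x)).
Proof.
move=> cd cl ci.
apply: (@eq_computable _ _ _ _ (fun x =>
  if prim_rec (l x) (fun _ s => if s is _ :: t then t else [::]) (i x) is a :: _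
  then a else d x)).
  move=> x; rewrite -[i x in RHS]addn0 -nth_drop -/(head _ _).
  have -> // : prim_rec (l x) (fun _ s => if s is _ :: t then t else [::]) (i x) =
    drop (i x) (l x).
  by elim: (i x) => [|k /= ->]; rewrite ?drop0 // -addn1 addnC -drop_drop;
    case: drop => //= ? ?; rewrite drop0.
computable_auto.
Qed.

End MoreSequenceFunctions.

#[export] Hint Extern 1 (computable (fun x => map _ _)) =>
  simple apply computable_map : computable.
#[export] Hint Extern 1 (computable (fun x => filter _ _)) =>
  simple apply computable_filter : computable.
#[export] Hint Extern 1 (computable (fun x => all _ _)) =>
  simple apply computable_all : computable.
#[export] Hint Extern 1 (computable (fun x => cat _ _)) =>
  simple apply computable_cat : computable.
#[export] Hint Extern 1 (computable (fun x => nth _ _ _)) =>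
  simple apply computable_nth : computable.

Section NumberSequences.
Context {X : Type} {cX : coded X}.

Lemma computable_iota (m n : X -> nat) : computable m -> computable n ->
  computable (fun x => iota (m x) (n x)).
Proof.
move=> cm cn.
apply: (@eq_computable _ _ _ _ (fun x => rev (prim_rec [::] (fun k s =>
  (m x + k) :: s) (n x)))).
  move=> x; elim: (n x) => // k IH.
  by rewrite -[in RHS]addn1 iotaD [LHS]rev_cons IH -cats1.
computable_auto.
Qed.

Lemma computable_mem (f : X -> nat) (l : X -> seq nat) : computable f -> computable l ->
  computable (fun x => f x \in l x).
Proof.
move=> cf cl.
apply: (@eq_computable _ _ _ _ (fun x => ~~ all (fun a => ~~ (a == f x)) (l x))).
  by move=> x; rewrite -has_predC /= -has_pred1; apply: eq_has => a /=; rewrite negbK.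
apply: computable_negb; apply: computable_all => //; computable_auto.
Qed.

End NumberSequences.

#[export] Hint Extern 1 (computable (fun x => iota _ _)) =>
  simple apply computable_iota : computable.
#[export] Hint Extern 1 (computable (fun x => _ \in _)) =>
  simple apply computable_mem : computable.

(** * Decision and search *)

Definition onto A (cA : coded A) : Prop := forall n, exists a : A, code a = n.
Arguments onto A {cA}.

Lemma onto_nat : onto nat. Proof. by move=> n; exists n. Qed.

Lemma onto_pair A B (cA : coded A) (cB : coded B) : onto A -> onto B -> onto (A * B).
Proof.
move=> oA oB n; have [a aE] := oA (fst_code n); have [b bE] := oB (snd_code n).
by exists (a, b); rewrite /code /coded_pair /= aE bE code_pairK.
Qed.

Lemma onto_seq A (cA : coded A) : onto A -> onto (seq A).
Proof.
move=> oA n; elim/ltn_ind: n => -[|n] IH; first by exists [::].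
have [a aE] := oA (fst_code n).
have [|s sE] := IH (snd_code n); first by rewrite ltnS -{2}(code_pairK n) leq_addl.
by exists (a :: s); rewrite code_cons /code /coded_pair /= aE sE code_pairK.
Qed.

(** A decision procedure for [A] may diverge on a number that codes nothing, whereas a
    search runs through all numbers. It is therefore called on the images of a type
    whose codes exhaust the numbers. *)
Lemma computable_oracle X T (cX : coded X) (cT : coded T) (A : set T) (f : X -> T) :
  decidable_set (@code T cT) A -> onto X -> computable f -> computable (fun x =>
    `[< A (f x) >]).
Proof.
move=> [cA cAP] oX [r [cr crP] rE]; have [d dK] := choice oX.
exists (fun n => code `[< A (f (d n)) >]).
  exists (Compose cA (fun _ : 'I_1 => cr)) => -[|n []] //= _.
  exists [:: r n]; split=> //.
    by move=> i; rewrite ord1; exact: (crP [:: n]).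
  have [yes no] := cAP (f (d n)); rewrite -{1}(dK n) rE.
  by case: asboolP => [/yes|/no].
move=> x; have fE : code (f (d (code x))) = code (f x) by rewrite -!rE dK.
have [yes no] := cAP (f x); have [yes' no'] := cAP (f (d (code x))).
rewrite fE in yes' no'; congr (code _).
case: asboolP => [/yes' c1|/no' c0]; case: asboolP => [/yes d1|/no d0] //.
  by have := computes_fun c1 d0.
by have := computes_fun d1 c0.
Qed.

Lemma decide_computable T (cT : coded T) (A : set T) (P : T -> bool) :
  computable P -> (forall t, A t <-> P t) -> decidable_set (@code T cT) A.
Proof.
move=> [r [c cr] rE] AP; exists c => t.
have : computes c [:: code t] (code (P t)) by rewrite -rE; exact: (cr [:: code t]).
by case Pt: (P t) => ct; split=> // At; [case: At|exfalso; have := AP t;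
  rewrite Pt => -[/(_ At)]];
  rewrite ?AP.
Qed.

(** The search returns not the zero [k] of [h] that it finds but [o k x], the answer
    to be drawn from it. *)
Lemma minimize h o : comp2 h -> comp2 o -> exists c : recf 1, forall x,
  (forall v, computes c [:: x] v -> exists2 k, h k x = 0 & v = o k x) /\
  (forall k, h k x = 0 -> exists v, computes c [:: x] v).
Proof.
move=> [ch hP] [co oP].
have cid : 0 < 1 by [].
exists (Compose co (fun i : 'I_2 => if i is Ordinal 0 _ then Mu ch else Proj (Ordinal
  cid))).
move=> x; split=> [v [zs [szs zsP ov]]|k hk].
  have [h0 _] := zsP (Ordinal (isT : 0 < 2)).
  have xE := zsP (Ordinal (isT : 1 < 2)).
  case: zs szs h0 xE ov {zsP} => [|k [|x' []]] //= _ h0 -> ov.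
  exists k; first exact: computes_fun (hP [:: k; x] erefl) h0.
  exact: computes_fun ov (oP [:: k; x] erefl).
pose p j := h j x == 0.
have ex_p : exists j, p j by exists k; rewrite /p hk.
case: (ex_minnP ex_p) => j /eqP hj minj.
exists (o j x), [:: j; x]; split=> //; last exact: (oP [:: j; x]).
case=> -[|[|//]] lt_i //=; split; first by rewrite -[X in computes _ _ X]hj;
  exact: (hP [:: j; x]).
move=> z lt_zj; exists (h z x).-1; rewrite prednK; first exact: (hP [:: z; x]).
by rewrite lt0n; apply: contraL lt_zj => hz; rewrite -leqNgt; exact: minj.
Qed.

Section Search.
Context {T Y : Type} {cT : coded T} {cY : coded Y}.
Hypothesis oY : onto Y.
Implicit Types (A : set T) (P Q : T -> Y -> bool).

Lemma search_realizer P : computable (fun u : T * Y => P u.1 u.2) ->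
  exists2 h, comp2 h & forall t y, h (code y) (code t) = (P t y : nat).
Proof.
move=> [r cr rE]; exists (fun k n => r (code_pair n k)).
  apply: rcomp_app1 cr _; apply: rcomp_app2 comp2_pair _ _; exact: rcomp_nth.
by move=> t y; exact: (rE (t, y)).
Qed.

Lemma comp2_complement h : comp2 h -> comp2 (fun k x => 1 - h k x).
Proof.
move=> ch; apply: (rcomp_app2 comp2_sub (g := fun xs =>
  h (nth 0 xs 0) (nth 0 xs 1))) => //.
exact: rcomp_const.
Qed.

Lemma re_search A P : computable (fun u : T * Y => P u.1 u.2) ->
  (forall t, A t <-> exists y, P t y) -> re_set (@code T cT) A.
Proof.
move=> /search_realizer[h ch hE] AP.
have [c cP] := minimize (comp2_complement ch) ch; exists c => t.
have [sound complete] := cP (code t); rewrite AP; split=> [[y Py]|[v /sound[k hk _]]].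
  by apply: (complete (code y)); rewrite hE Py.
have [y yk] := oY k; exists y; move: hk; rewrite -yk hE.
by case: (P t y).
Qed.

(** Post's theorem: search for a witness of either side. *)
Lemma decide_search A P Q : computable (fun u : T * Y => P u.1 u.2) ->
  computable (fun u : T * Y => Q u.1 u.2) ->
  (forall t, A t <-> exists y, P t y) -> (forall t, ~ A t <-> exists y, Q t y) ->
  decidable_set (@code T cT) A.
Proof.
move=> cP cQ AP AQ.
have [hP chP hPE] := search_realizer cP.
have cPQ : computable (fun u : T * Y => if P u.1 u.2 then true else Q u.1 u.2)
  by computable_auto.
have [h ch hE] := search_realizer (P := fun t y => if P t y then true else Q t y) cPQ.
have [c cP'] := minimize (comp2_complement ch) chP; exists c => t.
have [sound complete] := cP' (code t).
have [v cv] : exists v, computes c [:: code t] v.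
  have [/AP[y Py]|/AQ[y Qy]] := pselect (A t).
    by apply: (complete (code y)); rewrite hE Py.
  by apply: (complete (code y)); rewrite hE Qy if_same.
have [k hk vE] := sound _ cv; have [y yk] := oY k.
move: hk cv; rewrite {}vE -yk hE hPE; case Py: (P t y) => /= Qy cv; split=> // At.
- by case: At; apply/AP; exists y.
- by exfalso; apply: ((AQ t).2 _ At); exists y; case: (Q t y) Qy.
Qed.

End Search.

(** * Recursion on codes of formulas *)

Section FormulaFold.
Variables (S : finType) (B : Type).
Variables (z : B) (v : nat -> B) (i : B -> B -> B) (b : nat -> B -> B).

Fixpoint fm_fold (phi : fm S) : B :=
  match phi with
  | Bot => z
  | Var n => v n
  | Imp a c => i (fm_fold a) (fm_fold c)
  | Box e a => b (code_fin e) (fm_fold a)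
  end.

End FormulaFold.

#[export] Instance coded_fm (S : finType) : coded (fm S) := @code_fm S.

(** Course-of-values recursion: the values at the smaller numbers are kept in a list,
    the most recent one first. The codes of the components of a formula are smaller
    than its own. *)
Section CourseOfValues.
Variables (rz rv ri rb : nat -> nat).

(* The tests single out the tags 0, 1 and 2 of falsity, variables and implications;
   everything else is treated as a box. *)
Definition fold_step (x k : nat) (h : seq nat) : nat :=
  if fst_code k == 0 then rz x
  else if fst_code k == 1 then rv (code (x, snd_code k))
  else if fst_code k == 2 then
    ri (code (x, (nth 0 h (k - (fst_code (snd_code k)).+1),
                  nth 0 h (k - (snd_code (snd_code k)).+1))))
  else rb (code (x, (fst_code (snd_code k),
                     nth 0 h (k - (snd_code (snd_code k)).+1)))).

Definition fold_history (x : nat) : nat -> seq nat :=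
  prim_rec [::] (fun k h => fold_step x k h :: h).

Definition fold_code (x k : nat) : nat := fold_step x k (fold_history x k).

Lemma nth_fold_history x n j : j < n ->
  nth 0 (fold_history x n) (n - j.+1) = fold_code x j.
Proof.
elim: n => // n IH; rewrite ltnS subSS leq_eqVlt => /orP[/eqP->|lt_jn].
  by rewrite subnn.
by rewrite -IH // -(subnSK lt_jn).
Qed.

Hypotheses (cz : comp1 rz) (cv : comp1 rv) (ci : comp1 ri) (cb : comp1 rb).

Lemma computable_of_comp1 r : comp1 r -> computable r.
Proof. by move=> cr; exists r. Qed.

Lemma computable_fold_code : computable (fun u : nat * nat => fold_code u.1 u.2).
Proof.
have c1 := computable_of_comp1 comp1_fst; have c2 := computable_of_comp1 comp1_snd.
have cz' := computable_of_comp1 cz; have cv' := computable_of_comp1 cv.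
have ci' := computable_of_comp1 ci; have cb' := computable_of_comp1 cb.
have cs : computable (fun u : nat * (nat * seq nat) => fold_step u.1 u.2.1 u.2.2).
  by rewrite /fold_step; computable_auto.
by rewrite /fold_code /fold_history; computable_auto.
Qed.

End CourseOfValues.

Lemma computable_fm_fold {S : finType} {X B : Type} {cX : coded X} {cB : coded B}
    (z : X -> B) (v : X -> nat -> B) (i : X -> B -> B -> B) (b : X -> nat -> B -> B)
    (phi : X -> fm S) :
  computable z -> computable (fun u : X * nat => v u.1 u.2) ->
  computable (fun u : X * (B * B) => i u.1 u.2.1 u.2.2) ->
  computable (fun u : X * (nat * B) => b u.1 u.2.1 u.2.2) -> computable phi ->
  computable (fun x => fm_fold (z x) (v x) (i x) (b x) (phi x)).
Proof.
move=> [rz cz zE] [rv cv vE] [ri ci iE] [rb cb bE] [rp cp pE].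
have [r cr rE] := computable_fold_code cz cv ci cb.
exists (fun n => r (code_pair n (rp n))).
  by apply: comp1_comp cr _; apply: comp1_pair cp; exact: rcomp_nth.
move=> x; rewrite pE; set n := code x.
transitivity (fold_code rz rv ri rb n (code (phi x)));
  first exact: (rE (n, code (phi x))).
have lt_pair t k : 0 < t -> k < code_pair t k.
  move=> t_gt0; rewrite /code_pair -[X in X < _]add0n ltn_add2r bin_gt0.
  by rewrite ltnS addn_gt0 t_gt0.
elim: (phi x) => [|j|a IHa c IHc|e a IHa] //=; rewrite /fold_code /fold_step.
- by rewrite fst_codeK /= zE.
- by rewrite fst_codeK snd_codeK /= -(vE (x, j)).
- rewrite !fst_codeK !snd_codeK !fst_codeK /= !nth_fold_history ?IHa ?IHc.
  + exact: (iE (x, (_, _))).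
  + by apply: leq_ltn_trans (lt_pair _ _ _) => //; exact: leq_code_pairr.
  + by apply: leq_ltn_trans (lt_pair _ _ _) => //; exact: leq_code_pairl.
- rewrite !fst_codeK !snd_codeK !fst_codeK /= nth_fold_history ?IHa.
  + exact: (bE (x, (_, _))).
  + by apply: leq_ltn_trans (lt_pair _ _ _) => //; exact: leq_code_pairr.
Qed.

#[export] Hint Extern 1 (computable (fun x => fm_fold _ _ _ _ _)) =>
  simple apply computable_fm_fold : computable.

(** * Deciding validity in finite frames *)

(** A presentation whose numbers are not bounded: unlike those of presentations, the
    codes of raw frames exhaust the natural numbers, so that one can search among
    them. *)
Definition raw_frame : Type := nat * seq (nat * (nat * nat)).

Lemma onto_raw_frame : onto raw_frame.
Proof. do ![apply: onto_pair|apply: onto_seq|exact: onto_nat]. Qed.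

Section ModelChecker.
Variable S : finType.
Implicit Types (D : raw_frame) (phi : fm S).

Definition raw_worlds D : seq nat := iota 0 D.1.+1.

(** Valuations are given by finite tables: the truth value of the variable [i] at the
    world [w] is entry [i * #worlds + w] of the table [t]. *)
Definition truth_set D (t : seq nat) phi : seq nat :=
  fm_fold [::]
    (fun i => [seq w <- raw_worlds D | nth 0 t (i * D.1.+1 + w) == 1])
    (fun A B => [seq w <- raw_worlds D | (w \in A) ==> (w \in B)])
    (fun e A => [seq w <- raw_worlds D |
       all (fun a : nat * (nat * nat) =>
              ((a.1 == e) && (a.2.1 == w)) ==> (a.2.2 \in A)) D.2])
    phi.

Lemma computable_truth_set :
  computable (fun u : raw_frame * (seq nat * fm S) => truth_set u.1 u.2.1 u.2.2).
Proof. rewrite /truth_set /raw_worlds /raw_frame; computable_auto. Qed.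

Definition var_bound phi : nat :=
  fm_fold 0 succn addn (fun _ n => n) phi.

Lemma computable_var_bound : computable var_bound.
Proof. by rewrite /var_bound; computable_auto. Qed.

Definition tables (n : nat) : seq (seq nat) :=
  prim_rec [:: [::]]
    (fun _ ts => [seq 0 :: t | t <- ts] ++ [seq 1 :: t | t <- ts]) n.

Lemma computable_tables : computable tables.
Proof. by rewrite /tables; computable_auto. Qed.

Lemma mem_tables (f : nat -> bool) n : mkseq (fun k => f k : nat) n \in tables n.
Proof.
rewrite /mkseq; elim: n 0 => //= n IH m; rewrite mem_cat.
case: (f m); apply/orP; [right|left]; apply/map_f/IH.
Qed.

(** Only the values of the variables of the formula matter, so that finitely many
    tables cover all valuations. *)
Definition valid_in D phi : bool :=
  all (fun t => all (fun w => w \in truth_set D t phi) (raw_worlds D))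
      (tables (var_bound phi * D.1.+1)).

Lemma computable_valid_in :
  computable (fun u : raw_frame * fm S => valid_in u.1 u.2).
Proof.
have ct := computable_truth_set; have cb := computable_var_bound.
have cT := computable_tables.
rewrite /valid_in /raw_worlds /raw_frame; computable_auto.
Qed.

End ModelChecker.

Section CheckerCorrect.
Variable S : finType.
Implicit Types (D : finite_presentation S) (phi : fm S).

#[export] Instance coded_presentation : coded (finite_presentation S) :=
  @code_presentation S.

Definition raw_of D : raw_frame :=
  (fp_pred_card D,
   [seq (code_fin a.1.1, (val a.1.2, val a.2)) | a <- fp_arrows D]).

Lemma code_raw_of D : code (raw_of D) = code D.
Proof.
rewrite /code /coded_presentation /code_presentation /coded_pair /=.
congr (code_pair _ (code_seq _)); rewrite -map_comp.
by apply: eq_map => -[[e i] j].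
Qed.

Lemma computable_raw_of : computable raw_of.
Proof. exact: (computable_recode code_raw_of). Qed.

Lemma sat_var_bound (F : frame S) (V V' : nat -> world F -> Prop) phi (x : world F) :
  (forall i y, i < var_bound phi -> (V i y <-> V' i y)) ->
  sat (M := Model V) x phi <-> sat (M := Model V') x phi.
Proof.
elim: phi x => [|i|a IHa c IHc|e a IHa] x VV' //=.
- by apply: VV'; exact: ltnSn.
- rewrite IHa ?IHc // => i y lt_i; apply: VV'; apply: leq_trans lt_i _.
    exact: leq_addl.
  exact: leq_addr.
- by split=> xa y xy; apply/(IHa y VV')/xa.
Qed.

Definition table_val D (t : seq nat) (i : nat) (w : world (presented_frame D)) : Prop :=
  nth 0 t (i * (fp_pred_card D).+1 + val w) == 1.

Lemma code_fin_inj (T : finType) : injective (@code_fin T).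
Proof. by move=> x y /val_inj/enum_rank_inj. Qed.

Lemma mem_truth_set D t phi (w : world (presented_frame D)) :
  val w \in truth_set (raw_of D) t phi <->
  sat (M := Model (table_val t)) w phi.
Proof.
have : forall v : world (presented_frame D), val v \in raw_worlds (raw_of D).
  by move=> v; rewrite mem_iota; exact: ltn_ord.
rewrite /truth_set; move: (raw_worlds _) => ws in_ws.
elim: phi w => [|i|a IHa c IHc|e a IHa] w //=.
- by rewrite mem_filter in_ws andbT.
- rewrite mem_filter in_ws andbT -IHa -IHc; split=> [/implyP //|h].
  exact/implyP.
- rewrite mem_filter in_ws andbT; split=> [/allP h v ewv|h].
    rewrite -IHa.
    have /h /= : (code_fin e, (val w, val v)) \in (raw_of D).2.
      by apply/mapP; exists (e, w, v).
    by rewrite !eqxx.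
  apply/allP => _ /mapP[[[f u] v] fuv ->] /=.
  apply/implyP => /andP[/eqP/code_fin_inj fE /eqP/val_inj uE]; subst f u.
  exact/IHa/h.
Qed.

Lemma valid_inP D phi : valid_in (raw_of D) phi <-> frame_valid (presented_frame D) phi.
Proof.
split=> [/allP valid V w|valid].
  pose N := (fp_pred_card D).+1.
  pose f k := `[< V (k %/ N) (inord (k %% N)) >].
  have /valid/allP/(_ (val w)) := mem_tables f (var_bound phi * N).
  rewrite mem_iota ltn_ord => /(_ isT)/mem_truth_set.
  apply: (proj1 (sat_var_bound _ _)) => i y lt_i; rewrite /table_val.
  rewrite nth_mkseq; last first.
    by rewrite -ltn_divLR // divnMDl // divn_small ?ltn_ord // addn0.
  rewrite /f divnMDl // divn_small ?ltn_ord // addn0 modnMDl modn_small ?ltn_ord //.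
  rewrite inord_val; split=> [/eqP|Viy]; last by rewrite asboolT.
  by case: asboolP.
apply/allP => t _; apply/allP => w; rewrite mem_iota => /= lt_w.
exact/(mem_truth_set t phi (Ordinal lt_w))/valid.
Qed.

End CheckerCorrect.

(** * Presentations of finite frames *)

Section Presentations.
Variable S : finType.
Implicit Types (D : finite_presentation S) (F : frame S) (phi : fm S).

Definition to_arrow N (a : nat * (nat * nat)) : option (S * 'I_N.+1 * 'I_N.+1) :=
  if insub a.1 is Some e then
    if insub a.2.1 is Some i then
      if insub a.2.2 is Some j then Some (enum_val (e : 'I_#|S|), i, j) else None
    else None
  else None.

(** Arrows with a label or an end out of range are dropped, so that every raw frame
    denotes a frame, and every number the code of one. *)
Definition frame_of_raw (D : raw_frame) : finite_presentation S :=
  FinitePresentation (pmap (@to_arrow D.1) D.2).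

Lemma to_arrowK N :
  pcancel (fun a : S * 'I_N.+1 * 'I_N.+1 => (code_fin a.1.1, (val a.1.2, val a.2)))
          (@to_arrow N).
Proof.
move=> [[e i] j]; rewrite /to_arrow /=.
by rewrite /code_fin !valK enum_rankK.
Qed.

Lemma raw_ofK : cancel (@raw_of S) frame_of_raw.
Proof. by move=> [N l]; rewrite /frame_of_raw /= (map_pK (@to_arrowK N)). Qed.

Lemma computable_frame_of_raw : computable frame_of_raw.
Proof.
pose in_range (D : raw_frame) (a : nat * (nat * nat)) :=
  [&& a.1 < #|S|, a.2.1 < D.1.+1 & a.2.2 < D.1.+1].
have c_range : computable (fun u : raw_frame * (nat * (nat * nat)) => in_range u.1 u.2).
  by rewrite /in_range /raw_frame; computable_auto.
pose clean (D : raw_frame) : raw_frame := (D.1, [seq a <- D.2 | in_range D a]).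
have [r cr rE] : computable clean by rewrite /clean /raw_frame; computable_auto.
exists r => // -[N l]; rewrite rE /code /coded_presentation /code_presentation
  /coded_pair /=.
congr (code_pair _ (code_seq _)).
elim: l => //= -[k [m n]] l IH; rewrite /in_range /to_arrow /=.
case: insubP => [e -> ke|/negbTE-> //]; case: insubP => [i -> mi|/negbTE-> //].
case: insubP => [j -> nj|/negbTE-> //] /=; rewrite -IH; congr (_ :: _).
by rewrite /code_fin enum_valK ke mi nj.
Qed.

Lemma frame_valid_iso (F G : frame S) (f : world F -> world G)
  (g : world G -> world F) phi :
  cancel f g -> cancel g f -> (forall e x y, acc e x y <-> acc e (f x) (f y)) ->
  frame_valid F phi <-> frame_valid G phi.
Proof.
move=> fK gK accE.
have satE (V : nat -> world G -> Prop) x psi :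
    sat (M := Model (fun i y => V i (f y))) x psi <-> sat (M := Model V) (f x) psi.
  elim: psi x => [|i|a IHa b IHb|e a IHa] x //=; first by rewrite IHa IHb.
  split=> xa y; last by move=> /accE/xa/IHa.
  by rewrite -(gK y) => /accE/xa/IHa.
split=> valid V x; first by rewrite -(gK x) -satE; exact: valid.
have /satE := valid (fun i y => V i (g y)) (f x).
by apply: (proj1 (eq_sat _ _ _)) => i y; rewrite fK.
Qed.

Lemma finite_frame_presented F : finite_frame F ->
  exists D, forall phi, frame_valid (presented_frame D) phi <-> frame_valid F phi.
Proof.
case: F => W W0 R; rewrite /finite_frame /=.
elim/Pchoice: W => W in W0 R *; move=> /finite_seqP[s sE].
have [w0] := W0; pose u := undup s.
have in_u w : w \in u.
  by rewrite mem_undup; have : [set: W] w by []; rewrite sE.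
have uS : size u = (size u).-1.+1 by move: (in_u w0); case: (u).
pose f (i : 'I_(size u).-1.+1) := nth w0 u i.
have lt_u w : index w u < (size u).-1.+1 by rewrite -uS index_mem.
exists (FinitePresentation [seq a <- enum {: S * 'I_(size u).-1.+1 * 'I_(size
  u).-1.+1} |
  `[< R a.1.1 (f a.1.2) (f a.2) >]]) => phi.
apply: (@frame_valid_iso (presented_frame (FinitePresentation _)) (Frame W0 R)
  f (fun w => Ordinal (lt_u w))).
- move=> i; apply: val_inj; rewrite /= index_uniq ?undup_uniq //.
  by apply: leq_trans (ltn_ord i) _; rewrite -uS.
- by move=> w; rewrite /f /= nth_index.
- move=> e i j /=; rewrite mem_filter mem_enum inE andbT /=.
  exact: (iff_sym (rwP (asboolP _))).
Qed.

Lemma frame_of_presented (L : set (fm S)) F D :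
  (forall phi, frame_valid (presented_frame D) phi <-> frame_valid F phi) ->
  frame_of L (presented_frame D) <-> frame_of L F.
Proof. by move=> DF; split=> FL phi /FL /DF. Qed.

(** By the finite model property, a non-theorem is refuted by some finite frame of the
    logic, and both conditions on the frame can be tested. *)
Lemma co_re_logic (L : set (fm S)) : is_logic L ->
  admits_definable_filtration (Mod L) -> finite_frames_decidable L ->
  exists2 Q : fm S -> raw_frame -> bool,
    computable (fun u : fm S * raw_frame => Q u.1 u.2) &
    forall phi, ~ L phi <-> exists D : raw_frame, Q phi D.
Proof.
move=> HL fL dL; pose A := [set D : finite_presentation S | frame_of L
  (presented_frame D)].
have cA : computable (fun D : raw_frame => `[< A (frame_of_raw D) >]).
  apply: (@computable_oracle _ _ _ _ A _ dL onto_raw_frame).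
  exact: computable_frame_of_raw.
pose G (D : raw_frame) := `[< A (frame_of_raw D) >].
have cG : computable G := cA.
have cf := computable_frame_of_raw; have cr := @computable_raw_of S.
have cv := @computable_valid_in S.
exists (fun phi (D : raw_frame) => G D && ~~ valid_in (raw_of (frame_of_raw D)) phi).
  by computable_auto.
move=> phi; split=> [/(finite_countermodel HL fL)[F [finF FL nF]]|].
  have [D DF] := finite_frame_presented finF; exists (raw_of D).
  rewrite /G raw_ofK; apply/andP; split; first exact/asboolP/(frame_of_presented _ DF).
  by apply/negP => /valid_inP /DF.
by move=> [D /andP[/asboolP FL /negP nv]] Lphi; apply/nv/valid_inP/FL.
Qed.

End Presentations.

Section SharpFramesDecidable.
Variable S : finType.
Implicit Type L : set (fm S).

Lemma computable_axioms (T : finType) (X : set (fm T)) : finite_set X ->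
  exists2 P : raw_frame -> bool, computable P &
    forall D, P (raw_of D) <-> X `<=` frame_valid (presented_frame D).
Proof.
move=> /finite_set_list[l lX]; have cv := @computable_valid_in T.
exists (fun D => all (valid_in D) l); first by computable_auto.
move=> D; split=> [lD phi /lX|XD].
  suff allP s : all (valid_in (raw_of D)) s -> List.In phi s ->
      valid_in (raw_of D) phi by move/(allP _ lD)/valid_inP.
  by elim: s => //= a s IH /andP[va /IH sP] [<-|/sP].
have {}XD phi : List.In phi l -> valid_in (raw_of D) phi.
  by move/lX/XD => ?; exact/valid_inP.
elim: (l) XD => //= a s IH XD; rewrite XD ?IH //; last by left.
by move=> b sb; apply: XD; right.
Qed.

Lemma finitely_axiomatizable_frames L : finitely_axiomatizable L ->
  finite_frames_decidable L.
Proof.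
move=> [X [/computable_axioms[P cP PX] ->]]; have cr := @computable_raw_of S.
apply: (@decide_computable _ _ _ (fun D => P (raw_of D))); first by computable_auto.
by move=> D; rewrite /= frame_of_least_logic PX.
Qed.

Definition sharp_axiom_list : seq (fm (sharp S)) :=
  let p := Var 0 in
  flatten [seq [:: Iff (Box (Union ec.1 ec.2) p) (And (Box (Base ec.1) p)
    (Box (Base ec.2) p));
    Iff (Box (Seqc ec.1 ec.2) p) (Box (Base ec.1) (Box (Base ec.2) p));
    Imp (Box (Plus ec.1) p) (Box (Base ec.1) p);
    Imp (Box (Plus ec.1) p) (Box (Base ec.1) (Box (Plus ec.1) p));
    Imp (Box (Plus ec.1) (Imp p (Box (Base ec.1) p)))
        (Imp (Box (Base ec.1) p) (Box (Plus ec.1) p))]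
   | ec <- enum {: S * S}].

Lemma in_flatten_map (T : finType) U (f : T -> seq U) t x :
  List.In x (f t) -> List.In x (flatten [seq f t | t <- enum T]).
Proof.
move=> xt; have: t \in enum T by rewrite mem_enum.
elim: (enum T) => //= s l IH; rewrite in_cons => tl.
apply/List.in_or_app; case/orP: tl => [/eqP<-|/IH]; [by left|by right].
Qed.

Lemma sharp_axioms_list phi : @sharp_axioms S phi -> List.In phi sharp_axiom_list.
Proof.
move=> [e [c Aphi]]; apply: (@in_flatten_map _ _ _ (e, c)) => /=.
case: Aphi => [->|->|[->|->|->]]; tauto.
Qed.

Lemma sharp_axioms_finite : finite_set (@sharp_axioms S).
Proof. exact: list_finite_set sharp_axioms_list. Qed.

(** Labels other than the basic ones are sent out of range, so that the arrows
    bearing them are dropped by [frame_of_raw]. *)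
Definition base_table : seq nat :=
  [seq (if e is Base a then code_fin a else #|S|) | e <- enum {: sharp S}].

Definition raw_reduct (D : raw_frame) : raw_frame :=
  (D.1, [seq (nth 0 base_table a.1, a.2) | a <- D.2]).

Lemma computable_raw_reduct : computable raw_reduct.
Proof. by rewrite /raw_reduct /raw_frame; computable_auto. Qed.

Lemma raw_reduct_frame (D : finite_presentation (sharp S)) phi :
  frame_valid (presented_frame (frame_of_raw S (raw_reduct (raw_of D)))) phi <->
  frame_valid (reduct_frame (@Base S) (presented_frame D)) phi.
Proof.
case: D => N l.
apply: (@frame_valid_iso S
  (presented_frame (frame_of_raw S (raw_reduct (raw_of (FinitePresentation l)))))
  (reduct_frame (@Base S) (presented_frame (FinitePresentation l))) id id) =>
    // e i j /=.
rewrite mem_pmap -!map_comp.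
have tableE (f : sharp S) : nth 0 base_table (code_fin f) =
    if f is Base a then code_fin a else #|S|.
  by rewrite (nth_map f) ?nth_enum_rank // -cardE ltn_ord.
have arrowE (a : sharp S * 'I_N.+1 * 'I_N.+1) :
    to_arrow S N (nth 0 base_table (code_fin a.1.1), (val a.1.2, val a.2)) =
    if a.1.1 is Base f then Some (f, a.1.2, a.2) else None.
  case: a => [[f u] v]; rewrite tableE /=.
  case: f => [f|f g|f g|f]; first exact: (to_arrowK (f, u, v));
    by rewrite /to_arrow insubF //= ltnn.
split=> [/mapP[[[f u] v] fuv]|eij].
  rewrite [in RHS]/= (arrowE (f, u, v)) /=.
  by case: f fuv => // f fuv [-> -> ->].
by apply/mapP; exists (Base e, i, j) => //; rewrite /= (arrowE (Base e, i, j)).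
Qed.

(** A frame of the expansion is recognised by its reduct and by the finitely many new
    axioms; the interpretation of the compound labels is never computed. *)
Lemma sharp_frames_decidable L : finite_frames_decidable L ->
  finite_frames_decidable (sharp_logic L).
Proof.
move=> dL; pose A := [set D : finite_presentation S | frame_of L (presented_frame D)].
pose G (D : raw_frame) := `[< A (frame_of_raw S D) >].
have cG : computable G.
  apply: (@computable_oracle _ _ _ _ A _ dL onto_raw_frame).
  exact: computable_frame_of_raw.
have [P cP PA] := computable_axioms sharp_axioms_finite.
have cr := @computable_raw_of (sharp S); have cd := computable_raw_reduct.
apply: (@decide_computable _ _ _
  (fun D => G (raw_reduct (raw_of D)) && P (raw_of D))); first by computable_auto.
move=> D; rewrite /= frame_of_sharp -PA.
rewrite -(frame_of_presented L (raw_reduct_frame D)).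
by split=> [[/asboolP GD PD]|/andP[/asboolP]]; first exact/andP.
Qed.

End SharpFramesDecidable.

(** * Enumerating the theorems of a finitely axiomatizable logic *)

Section ReadingCodes.
Variable S : finType.
Implicit Types phi A : fm S.

Fixpoint read_upto (fuel n : nat) : fm S :=
  if fuel is m.+1 then
    let r := snd_code n in
    if fst_code n == 1 then Var r
    else if fst_code n == 2 then Imp (read_upto m (fst_code r))
      (read_upto m (snd_code r))
    else if fst_code n == 3 then
      if insub (fst_code r) is Some e then Box (enum_val (e : 'I_#|S|))
        (read_upto m (snd_code r))
      else Bot
    else Bot
  else Bot.

(** Every number is read as some formula, so that the enumeration need not tell
    the codes of formulas from the other numbers. *)
Definition read (n : nat) : fm S := read_upto n.+1 n.

Lemma ltn_snd_code n t : fst_code n = t.+1 -> snd_code n < n.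
Proof.
move=> nt; rewrite -[X in _ < X]code_pairK nt /code_pair -[X in X < _]add0n.
by rewrite ltn_add2r bin_gt0 ltnS addSn.
Qed.

Lemma read_uptoE fuel n : n < fuel -> read_upto fuel n = read n.
Proof.
suff same k l m : m < k -> m < l -> read_upto k m = read_upto l m.
  by move=> lt_n; apply: same.
elim: k l m => // k IH [|l] m //; rewrite !ltnS => le_k le_l /=.
have sub t j : fst_code m = t.+1 -> j <= snd_code m -> read_upto k j = read_upto l j.
  move=> mt le_j; have lt_j := leq_ltn_trans le_j (ltn_snd_code mt).
  by apply: IH; exact: leq_trans lt_j _.
have le1 : fst_code (snd_code m) <= snd_code m.
  by rewrite -{2}(code_pairK (snd_code m)) leq_code_pairl.
have le2 : snd_code (snd_code m) <= snd_code m.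
  by rewrite -{2}(code_pairK (snd_code m)) leq_code_pairr.
case: eqP => // _; case: eqP => [m2|_]; first by rewrite !(sub 1).
by case: eqP => // m3; case: insub => // e; rewrite (sub 2).
Qed.

Lemma readE n :
  read n =
  if fst_code n == 1 then Var (snd_code n)
  else if fst_code n == 2 then
    Imp (read (fst_code (snd_code n))) (read (snd_code (snd_code n)))
  else if fst_code n == 3 then
    if insub (fst_code (snd_code n)) is Some e
    then Box (enum_val (e : 'I_#|S|)) (read (snd_code (snd_code n)))
    else Bot
  else Bot.
Proof.
have le1 : fst_code (snd_code n) <= snd_code n.
  by rewrite -{2}(code_pairK (snd_code n)) leq_code_pairl.
have le2 : snd_code (snd_code n) <= snd_code n.
  by rewrite -{2}(code_pairK (snd_code n)) leq_code_pairr.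
have part k t : fst_code n = t.+1 -> k <= snd_code n -> read_upto n k = read k.
  by move=> nt le_k; apply/read_uptoE/(leq_ltn_trans le_k)/(ltn_snd_code nt).
change (read n) with (read_upto n.+1 n); rewrite [read_upto n.+1 n]/=.
case: eqP => // _; case: eqP => [n2|_]; first by rewrite !(part _ 1).
by case: eqP => // n3; case: insubP => // e _ _; rewrite (part _ 2).
Qed.

Lemma read_Imp a b : read (code_pair 2 (code_pair a b)) = Imp (read a) (read b).
Proof. by rewrite readE !(fst_codeK, snd_codeK). Qed.

Lemma read_Box (e : S) a : read (code_pair 3 (code_pair (code_fin e) a))
  = Box e (read a).
Proof. by rewrite readE !(fst_codeK, snd_codeK) /= valK enum_rankK. Qed.

Lemma read_Bot : read (code_pair 0 0) = Bot.
Proof. by rewrite readE fst_codeK. Qed.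

Lemma read_code phi : read (code phi) = phi.
Proof.
rewrite /code /coded_fm; elim: phi => [|i|a IHa b IHb|e a IHa].
- exact: read_Bot.
- by rewrite readE fst_codeK snd_codeK.
- by rewrite [code_fm _]/= read_Imp IHa IHb.
- by rewrite [code_fm _]/= read_Box IHa.
Qed.

(** Substitution performed on codes. As the axioms are fixed, the recursion on the
    formula takes place outside the program. *)
Fixpoint instance_code (A : fm S) (p : seq nat) : nat :=
  match A with
  | Bot => code_pair 0 0
  | Var i => nth 0 p i
  | Imp a b => code_pair 2 (code_pair (instance_code a p) (instance_code b p))
  | Box e a => code_pair 3 (code_pair (code_fin e) (instance_code a p))
  end.

Lemma computable_pair_code {X} {cX : coded X} (f g : X -> nat) :
  computable f -> computable g -> computable (fun x => code_pair (f x) (g x)).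
Proof. by move=> cf cg; apply: (@computable_code X _ _ _ (fun x => (f x, g x)));
  computable_auto. Qed.

Lemma computable_instance_code A : computable (instance_code A).
Proof.
elim: A => [|i|a IHa b IHb|e a IHa] /=.
- exact: computable_const.
- by computable_auto.
- by apply: computable_pair_code; [exact: computable_const|exact: computable_pair_code].
- by do 2![apply: computable_pair_code; first exact: computable_const].
Qed.

Lemma read_instance A p : read (instance_code A p) = subst (fun i =>
  read (nth 0 p i)) A.
Proof.
elim: A => [||a IHa b IHb|e a IHa] //.
- by rewrite [instance_code _ _]/= read_Imp IHa IHb.
- by rewrite [instance_code _ _]/= read_Box IHa.
Qed.

Lemma instance_code_subst A s n : var_bound A <= n ->
  instance_code A (mkseq (fun i => code (s i)) n) = code (subst s A).
Proof.
elim: A => [|i|a IHa b IHb|e a IHa] //= le_n; first by rewrite nth_mkseq.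
- by rewrite IHa ?IHb //; apply: leq_trans le_n; [exact: leq_addl|exact: leq_addr].
- by rewrite IHa.
Qed.

End ReadingCodes.

Section ProofMachine.
Variables (S : finType) (X : seq (fm S)).

Definition axiom_code (l : seq (fm S)) (j : nat) (p : seq nat) : nat :=
  nth 0 [seq instance_code A p | A <- l] j.

Lemma computable_axiom_code l :
  computable (fun u : nat * seq nat => axiom_code l u.1 u.2).
Proof.
rewrite /axiom_code; apply: computable_nth; [by computable_auto| |by computable_auto].
elim: l => [|A l IH] /=; first exact: computable_const.
by have cA := computable_instance_code A; apply: computable_cons => //; computable_auto.
Qed.

(** Derivations in postfix form drive a stack of theorems. An instruction is an
    opcode with its parameters: 0 is modus ponens, 1 is necessitation, and the
    other ones push an instance of an axiom. An instruction that cannot be obeyed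
    is skipped. *)
Definition machine_step (st : seq nat) (op : nat * seq nat) : seq nat :=
  if op.1 == 0 then
    if st is x :: st1 then
      if st1 is f :: st2 then
        if f == code_pair 2 (code_pair x (snd_code (snd_code f)))
        then snd_code (snd_code f) :: st2 else st
      else st
    else st
  else if op.1 == 1 then
    if nth 0 op.2 0 < #|S| then
      if st is x :: st1 then code_pair 3 (code_pair (nth 0 op.2 0) x) :: st1 else st
    else st
  else if op.1 - 2 < size (hilbert_axioms X) then
    axiom_code (hilbert_axioms X) (op.1 - 2) op.2 :: st
  else st.

Lemma computable_machine_step :
  computable (fun u : seq nat * (nat * seq nat) => machine_step u.1 u.2).
Proof.
have c2 := computable_of_comp1 comp1_snd.
have ca := computable_axiom_code (hilbert_axioms X).
pose imp (x : nat) (y : nat) := code_pair 2 (code_pair x y).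
pose box (x : nat) (y : nat) := code_pair 3 (code_pair x y).
have cimp : computable (fun u : nat * nat => imp u.1 u.2).
  by do 2![apply: computable_pair_code; try exact: computable_const]; computable_auto.
have cbox : computable (fun u : nat * nat => box u.1 u.2).
  by do 2![apply: computable_pair_code; try exact: computable_const]; computable_auto.
rewrite /machine_step; set sz := size _; set axs := hilbert_axioms X in ca *.
have E (u : seq nat * (nat * seq nat)) : machine_step u.1 u.2 = 
  if u.2.1 == 0 then
    if u.1 is x :: st1 then
      if st1 is f :: st2 then
        if f == imp x (snd_code (snd_code f))
        then snd_code (snd_code f) :: st2 else u.1
      else u.1
    else u.1
  else if u.2.1 == 1 then
    if nth 0 u.2.2 0 < #|S| then
      if u.1 is x :: st1 then box (nth 0 u.2.2 0) x :: st1 else u.1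
    else u.1
  else if u.2.1 - 2 < sz then axiom_code axs (u.2.1 - 2) u.2.2 :: u.1 else u.1 by [].
by apply: eq_computable (fsym E) _; computable_auto.
Qed.

Definition run (ops : seq (nat * seq nat)) (st : seq nat) : seq nat :=
  foldl machine_step st ops.

(** Numbers that code no formula may occur on the stack; they too are read as
    theorems, since reading commutes with implications and boxes. *)
Lemma run_sound ops st : (forall n, n \in st -> derivable X (read S n)) ->
  forall n, n \in run ops st -> derivable X (read S n).
Proof.
elim: ops st => // -[k p] ops IH st Dst; apply: IH => n.
rewrite /machine_step /=; case: (k =P 0) => _.
  case: st Dst => [|x [|f st]] // Dst.
    by move=> n_in; exact: Dst.
  case: eqP => [fE|_]; last exact: Dst.
  rewrite in_cons => /orP[/eqP->|n_in]; last by apply: Dst; rewrite !in_cons n_in !orbT.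
  apply: (@der_mp _ _ (read S x)); last by apply: Dst; rewrite mem_head.
  by rewrite -read_Imp -fE; apply: Dst; rewrite !in_cons eqxx orbT.
case: (k =P 1) => _.
  case: ifP => [lt_e|_]; last exact: Dst.
  case: st Dst => // x st Dst; rewrite in_cons => /orP[/eqP->|n_in].
    have -> : nth 0 p 0 = code_fin (enum_val (Ordinal lt_e)).
      by rewrite /code_fin enum_valK.
    by rewrite read_Box; apply/der_nec/Dst; rewrite mem_head.
  by apply: Dst; rewrite in_cons n_in orbT.
case: ifP => [lt_j|_]; last exact: Dst.
rewrite in_cons => /orP[/eqP->|]; last exact: Dst.
by rewrite /axiom_code (nth_map Bot) // read_instance; exact: der_axiom.
Qed.

(** The program leaves what lies below its result untouched, so that the programs for
    the premises of a rule can be concatenated. *)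
Lemma run_complete phi : derivable X phi ->
  exists ops, forall st, run ops st = code phi :: st.
Proof.
elim=> [s i lt_i|a b _ [ops1 E1] _ [ops2 E2]|e a _ [ops E]].
- exists [:: (i.+2, mkseq (fun j => code (s j)) (var_bound (nth Bot (hilbert_axioms X)
  i)))].
  move=> st; rewrite /run /= /machine_step /= subn2 /= lt_i.
  by rewrite /axiom_code (nth_map Bot) // instance_code_subst.
- exists (ops1 ++ ops2 ++ [:: (0, [::])]) => st.
  rewrite /run !foldl_cat -!/(run _ _) E1 E2 /= /machine_step /=.
  have codeE : code (Imp a b) = code_pair 2 (code_pair (code a) (code b)) by [].
  by rewrite codeE !snd_codeK eqxx.
- exists (ops ++ [:: (1, [:: code_fin e])]) => st.
  rewrite /run foldl_cat -/(run ops st) E /= /machine_step /=.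
  by rewrite /code_fin ltn_ord.
Qed.

Lemma derivable_search :
  exists2 P : fm S -> seq (nat * seq nat) -> bool,
    computable (fun u : fm S * seq (nat * seq nat) => P u.1 u.2) &
    forall phi, derivable X phi <-> exists ops, P phi ops.
Proof.
have cs := computable_machine_step.
exists (fun phi ops => code phi \in run ops [::]).
  by rewrite /run; computable_auto.
move=> phi; split=> [/run_complete[ops E]|[ops]].
  by exists ops; rewrite E mem_head.
by move/run_sound => /(_ (fun n n0 => False_ind _ (notF n0))); rewrite read_code.
Qed.

End ProofMachine.

Lemma onto_program : onto (seq (nat * seq nat)).
Proof. by apply: onto_seq; apply: onto_pair; [exact: onto_nat|apply: onto_seq;
  exact: onto_nat]. Qed.

(** * Sharp expansions of finitely axiomatizable logics *)

Section SharpAxiomatizable.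
Variable S : finType.
Implicit Type L : set (fm S).

Lemma rename_subst T (f : S -> T) s phi :
  rename f (subst s phi) = subst (fun i => rename f (s i)) (rename f phi).
Proof. by elim: phi => //= [a -> b ->|e a ->]. Qed.

Lemma prop_eval_rename T (f : S -> T) v phi :
  prop_eval v (rename f phi) = prop_eval (fun a => v (rename f a)) phi.
Proof. by elim: phi => //= a -> b ->. Qed.

(** This is why the expansion of an axiomatized logic is axiomatized by the renamed
    axioms and the new ones. *)
Lemma rename_logic T (f : S -> T) (L : set (fm T)) :
  is_logic L -> is_logic [set phi | L (rename f phi)].
Proof.
move=> HL; split=> [phi taut|e|a b Lab La|s a La|e a La] /=.
- by apply: (logic_taut HL) => v; rewrite prop_eval_rename; exact: taut.
- exact: (logic_K HL (f e)).
- exact: (logic_mp HL Lab La).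
- by rewrite rename_subst; exact: (logic_subst HL).
- exact: (logic_nec HL).
Qed.

Lemma sharp_finitely_axiomatizable L : finitely_axiomatizable L ->
  finitely_axiomatizable (sharp_logic L).
Proof.
move=> [X [finX ->]]; exists ([set rename (@Base S)
  phi | phi in X] `|` @sharp_axioms S).
split; first by rewrite finite_setU; split;
  [exact: finite_image|exact: sharp_axioms_finite].
have HS := least_logic_logic ([set rename (@Base S)
  phi | phi in X] `|` @sharp_axioms S).
apply/seteqP; split=> phi Lphi M HM XM; apply: Lphi => //.
  move=> t [[a La <-]|At]; last by apply: XM; right.
  apply: (La _ (rename_logic (@Base S) HM)) => b Xb /=.
  by apply: XM; left; exists b.
move=> t [[a Xa <-]|At]; apply: XM; [left|by right].
by exists a => //; exact: least_logic_sub.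
Qed.

Lemma re_logic L : finitely_axiomatizable L ->
  exists2 P : fm S -> seq (nat * seq nat) -> bool,
    computable (fun u : fm S * seq (nat * seq nat) => P u.1 u.2) &
    forall phi, L phi <-> exists ops, P phi ops.
Proof.
move=> [X [/finite_set_list[l lX] ->]].
have <- : [set phi | List.In phi l] = X by apply/seteqP; split=> phi /lX.
by rewrite -derivableE; exact: derivable_search.
Qed.

End SharpAxiomatizable.

(** Theorems are found by running programs and non-theorems by examining frames; the
    two searches are made to range over the pairs of a program and a frame. *)
Lemma decidable_logic (S : finType) (L : set (fm S)) : is_logic L ->
  admits_definable_filtration (Mod L) -> finitely_axiomatizable L ->
  decidable_set (@code_fm S) L.
Proof.
move=> HL fL faL; have [P cP PL] := re_logic faL.
have [Q cQ QL] := co_re_logic HL fL (finitely_axiomatizable_frames faL).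
apply: (@decide_search (fm S) (seq (nat * seq nat) * raw_frame) _ _
  (onto_pair onto_program onto_raw_frame) L (fun phi u => P phi u.1) (fun phi u =>
    Q phi u.2)).
- by computable_auto.
- by computable_auto.
- by move=> phi; rewrite PL; split=> [[ops Pops]|[u Pu]];
  [exists (ops, (0, [::]))|exists u.1].
- by move=> phi; rewrite QL; split=> [[D QD]|[u Qu]]; [exists ([::], D)|exists u.2].
Qed.

Theorem theorem4p6 (S : finType) (L : set (fm S)) (L_logic : is_logic L)
    (L_filtr : admits_definable_filtration (Mod L)) (n : nat) :
  [/\ admits_definable_filtration (Mod (logic_iter L n)),
      finite_model_property (logic_iter L n) /\
        kripke_complete (logic_iter L n),
      finitely_axiomatizable L ->
        decidable_set (@code_fm (sharp_iter S n)) (logic_iter L n) &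
      finite_frames_decidable L ->
        co_re_set (@code_fm (sharp_iter S n)) (logic_iter L n)].
Proof.
have HLn := logic_iter_logic n L_logic.
have fLn := logic_iter_filtration (n := n) L_logic L_filtr.
split=> //.
- have LnE := logic_of_finite_frames HLn fLn; split.
    by exists (fun F => finite_frame F /\ frame_of (logic_iter L n) F); split=> // F [].
  by exists (fun F => finite_frame F /\ frame_of (logic_iter L n) F).
- move=> faL; apply: decidable_logic => //.
  by elim: (n) => //= k; exact: sharp_finitely_axiomatizable.
- move=> dL; have dLn : finite_frames_decidable (logic_iter L n).
    by elim: (n) => //= k; exact: sharp_frames_decidable.
  have [Q cQ QL] := co_re_logic HLn fLn dLn.
  exact: (re_search onto_raw_frame cQ QL).
Qed.
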